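(* Let $\mathbf{X}^*\in\mathbb{P}^2_{\mathbb{R}}$ be an isolated real zero of a nonnegative ternary form $P\in P_{3,d}$ with $m_{\mathbf{X}^*}(P)=2$. Then $\delta_{\mathbf{X}^*}(P)=\delta^{\mathrm{sos}}_{\mathbf{X}^*}(P)$.
   Context: $P_{3,d}$ is the set of real ternary forms of degree $d$ that are nonnegative on $\mathbb{R}^3$. $m_{\mathbf{X}^*}(P)$ is the order of vanishing (multiplicity) of $P$ at $\mathbf{X}^*$. Delta invariant. For $f\in\mathbb{C}[x_1,x_2]$ and a point $\mathbf{x}^*$ of the curve $f=0$, let $\mathcal{O}_{\mathbf{x}^*}$ be the local ring of $\mathbb{A}^2_{\mathbb{C}}$ at $\mathbf{x}^*$ and $\mathcal{O}_{f,\mathbf{x}^*}=\mathcal{O}_{\mathbf{x}^*}/(f)$. Then $\delta_{\mathbf{x}^*}(f)=\dim_{\mathbb{C}}\big(\overline{\mathcal{O}_{f,\mathbf{x}^*}}/\mathcal{O}_{f,\mathbf{x}^*}\big)$, where the bar denotes integral closure (in the total ring of fractions). SOS-invariant. Let $f\in\mathbb{R}[x_1,x_2]$ be nonzero, nonnegative near an isolated real zero $\mathbf{x}^*=(a,b)$. Let $m=m_{\mathbf{x}^*}(f)$ be its order of vanishing at $\mathbf{x}^*$ and $f_m$ the degree $m$ homogeneous part of $f(\mathbf{x}^*+\cdot)$. The first order infinitely near points of $f=0$ at $\mathbf{x}^*$ are the (distinct) points $[X_1':X_2']\in\mathbb{P}^1_{\mathbb{C}}$ with $f_m(X_1',X_2')=0$;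 such a point is real if it lies in $\mathbb{P}^1_{\mathbb{R}}$. At a point $[c:1]$ the strict transform is $f'(u,v)=f(a+uv,b+v)/v^m$, considered at $\mathbf{x}'=(c,0)$; at the point $[1:0]$ it is $f'(u,v)=f(a+u,b+uv)/u^m$, considered at $\mathbf{x}'=(0,0)$. The point $\mathbf{x}^*$ is an ordinary singularity if $m=2$ and the Hessian matrix of $f$ at $\mathbf{x}^*$ is nondegenerate. The SOS-invariant is defined recursively by $\delta^{\mathrm{sos}}_{\mathbf{x}^*}(f)=1$ for an ordinary singularity and in general $$\delta^{\mathrm{sos}}_{\mathbf{x}^*}(f)=\frac{m^2}{4}+\sum_{\mathbf{x}'\text{ real}}\delta^{\mathrm{sos}}_{\mathbf{x}'}(f'),$$ the sum being over the real first order infinitely near points of $f=0$ at $\mathbf{x}^*$. For a form $P$, $\delta_{\mathbf{X}^*}(P):=\delta_{\mathbf{x}^*}(p)$ and $\delta^{\mathrm{sos}}_{\mathbf{X}^*}(P):=\delta^{\mathrm{sos}}_{\mathbf{x}^*}(p)$, where $p$ is a dehomogenization of $P$ in an affine chart containing $\mathbf{X}^*$ and $\mathbf{x}^*$ is the corresponding affine point. *)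

(* Defs.v *)
From HB Require Import structures.
From mathcomp Require Import all_boot all_order all_algebra.
From mathcomp Require Import generic_quotient ring_quotient.
From mathcomp Require Import ring boolp reals.
From mathcomp Require Import complex mpoly.

Set Implicit Arguments.
Unset Strict Implicit.
Unset Printing Implicit Defensive.

Import GRing.Theory Num.Theory.
Local Open Scope ring_scope.
Local Open Scope quotient_scope.

(* -------------------------------------------------------------------- *)
(* Localization of a commutative ring A (possibly with zero divisors) at a
   multiplicative set S. The hypothesis 0 \notin S only serves to make the
   result a nontrivial ring. *)
Section Localization.
Variables (A : comNzRingType) (S : mulrClosed A) (S0 : 0 \notin S).

Definition loc_denom := {s : A | s \in S}.
Definition loc_frac : Type := (A * loc_denom)%type.
HB.instance Definition _ := Choice.on loc_frac.

Definition loc_equiv (x y : loc_frac) : bool :=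
  `[< exists2 t, t \in S & t * (x.1 * sval y.2) = t * (y.1 * sval x.2) >].

Lemma loc_equivP x y :
  reflect (exists2 t, t \in S & t * (x.1 * sval y.2) = t * (y.1 * sval x.2))
          (loc_equiv x y).
Proof. exact: asboolP. Qed.

Lemma loc_equiv_is_equiv : equiv_class_of loc_equiv.
Proof.
split=> [x|x y|y x z].
- by apply/loc_equivP; exists 1 => //; apply: rpred1.
- by apply/loc_equivP/loc_equivP => -[t tS e]; exists t.
move=> /loc_equivP[t tS e] /loc_equivP[u uS e'].
apply/loc_equivP; exists (t * u * sval y.2).
  by rewrite !rpredM ?(valP y.2).
transitivity (u * sval z.2 * (t * (x.1 * sval y.2))); first by ring.
rewrite e; transitivity (t * sval x.2 * (u * (y.1 * sval z.2))); first by ring.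
by rewrite e'; ring.
Qed.

Canonical loc_equiv_equiv := EquivRelPack loc_equiv_is_equiv.
Canonical loc_equiv_encModRel := defaultEncModRel loc_equiv.

Definition loc_of of 0 \notin S := {eq_quot loc_equiv}.
Local Notation L := (loc_of S0).
HB.instance Definition _ : EqQuotient loc_frac loc_equiv L := EqQuotient.on L.
HB.instance Definition _ := Choice.on L.

Definition loc_mk (a : A) (s : loc_denom) : L := \pi_L (a, s).

Lemma loc_mkP a s b t :
  loc_mk a s = loc_mk b t <->
  exists2 u, u \in S & u * (a * sval t) = u * (b * sval s).
Proof.
split=> [/eqP|h]; first by rewrite piE => /loc_equivP.
by apply/eqP; rewrite piE; apply/loc_equivP.
Qed.

Lemma loc_mk_ex (z : L) : exists a s, z = loc_mk a s.
Proof.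
exists (repr z).1, (repr z).2; rewrite /loc_mk -surjective_pairing.
by rewrite reprK.
Qed.

Definition loc_denom1 : loc_denom := exist _ 1 (rpred1 S).
Definition loc_denomM (s t : loc_denom) : loc_denom :=
  exist _ (sval s * sval t) (rpredM (valP s) (valP t)).

Definition loc_add (x y : L) : L :=
  loc_mk ((repr x).1 * sval (repr y).2 + (repr y).1 * sval (repr x).2)
         (loc_denomM (repr x).2 (repr y).2).
Definition loc_opp (x : L) : L := loc_mk (- (repr x).1) (repr x).2.
Definition loc_mul (x y : L) : L :=
  loc_mk ((repr x).1 * (repr y).1) (loc_denomM (repr x).2 (repr y).2).

Let repr_mk a s : exists2 u, u \in S &
  u * ((repr (loc_mk a s)).1 * sval s)
    = u * (a * sval (repr (loc_mk a s)).2).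
Proof.
by apply/loc_mkP; rewrite /loc_mk -surjective_pairing reprK.
Qed.

Lemma loc_addE a s b t :
  loc_add (loc_mk a s) (loc_mk b t)
    = loc_mk (a * sval t + b * sval s) (loc_denomM s t).
Proof.
have [u uS eu] := repr_mk a s; have [v vS ev] := repr_mk b t.
apply/loc_mkP; exists (u * v); first exact: rpredM.
move: eu ev; rewrite /=; set x := repr (loc_mk a s); set y := repr (loc_mk b t).
move=> eu ev.
transitivity (u * (x.1 * sval s) * v * sval y.2 * sval t
  + v * (y.1 * sval t) * u * sval x.2 * sval s); first by ring.
by rewrite eu ev; ring.
Qed.

Lemma loc_oppE a s : loc_opp (loc_mk a s) = loc_mk (- a) s.
Proof.
have [u uS eu] := repr_mk a s; apply/loc_mkP; exists u => //.
by rewrite !mulNr !mulrN eu.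
Qed.

Lemma loc_mulE a s b t :
  loc_mul (loc_mk a s) (loc_mk b t) = loc_mk (a * b) (loc_denomM s t).
Proof.
have [u uS eu] := repr_mk a s; have [v vS ev] := repr_mk b t.
apply/loc_mkP; exists (u * v); first exact: rpredM.
move: eu ev; rewrite /=; set x := repr (loc_mk a s); set y := repr (loc_mk b t).
move=> eu ev.
transitivity (u * (x.1 * sval s) * (v * (y.1 * sval t))); first by ring.
by rewrite eu ev; ring.
Qed.

Let mk_eq a s b t : a * sval t = b * sval s -> loc_mk a s = loc_mk b t.
Proof. by move=> e; apply/loc_mkP; exists 1; rewrite ?rpred1 ?e. Qed.

Lemma loc_addA : associative loc_add.
Proof.
move=> x y z; have [a [s ->]] := loc_mk_ex x.
have [b [t ->]] := loc_mk_ex y; have [c [u ->]] := loc_mk_ex z.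
by rewrite !loc_addE; apply: mk_eq => /=; ring.
Qed.

Lemma loc_addC : commutative loc_add.
Proof.
move=> x y; have [a [s ->]] := loc_mk_ex x; have [b [t ->]] := loc_mk_ex y.
by rewrite !loc_addE; apply: mk_eq => /=; ring.
Qed.

Lemma loc_add0 : left_id (loc_mk 0 loc_denom1) loc_add.
Proof.
move=> x; have [a [s ->]] := loc_mk_ex x.
by rewrite !loc_addE; apply: mk_eq => /=; ring.
Qed.

Lemma loc_addN : left_inverse (loc_mk 0 loc_denom1) loc_opp loc_add.
Proof.
move=> x; have [a [s ->]] := loc_mk_ex x.
by rewrite loc_oppE !loc_addE; apply: mk_eq => /=; ring.
Qed.

HB.instance Definition _ :=
  GRing.isZmodule.Build L loc_addA loc_addC loc_add0 loc_addN.

Lemma loc_mulA : associative loc_mul.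
Proof.
move=> x y z; have [a [s ->]] := loc_mk_ex x.
have [b [t ->]] := loc_mk_ex y; have [c [u ->]] := loc_mk_ex z.
by rewrite !loc_mulE; apply: mk_eq => /=; ring.
Qed.

Lemma loc_mulC : commutative loc_mul.
Proof.
move=> x y; have [a [s ->]] := loc_mk_ex x; have [b [t ->]] := loc_mk_ex y.
by rewrite !loc_mulE; apply: mk_eq => /=; ring.
Qed.

Lemma loc_mul1 : left_id (loc_mk 1 loc_denom1) loc_mul.
Proof.
move=> x; have [a [s ->]] := loc_mk_ex x.
by rewrite !loc_mulE; apply: mk_eq => /=; ring.
Qed.

Lemma loc_mulDl : left_distributive loc_mul +%R.
Proof.
move=> x y z; have [a [s ->]] := loc_mk_ex x.
have [b [t ->]] := loc_mk_ex y; have [c [u ->]] := loc_mk_ex z.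
rewrite /+%R /= !(loc_addE, loc_mulE).
by apply: mk_eq => /=; ring.
Qed.

Lemma loc_1_neq0 : loc_mk 1 loc_denom1 != 0 :> L.
Proof.
apply/eqP => /loc_mkP[u uS] /=; rewrite mul0r !mulr1 mulr0 => u0.
by move: S0; rewrite -u0 uS.
Qed.

HB.instance Definition _ := GRing.Zmodule_isComNzRing.Build L
  loc_mulA loc_mulC loc_mul1 loc_mulDl loc_1_neq0.

Definition loc_inj (a : A) : L := loc_mk a loc_denom1.

Lemma loc_inj_is_zmod_morphism : zmod_morphism loc_inj.
Proof.
move=> a b; rewrite /loc_inj.
have -> : loc_mk a loc_denom1 - loc_mk b loc_denom1
  = loc_add (loc_mk a loc_denom1) (loc_opp (loc_mk b loc_denom1)) by [].
by rewrite loc_oppE loc_addE; apply: mk_eq => /=; ring.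
Qed.
HB.instance Definition _ :=
  GRing.isZmodMorphism.Build A L loc_inj loc_inj_is_zmod_morphism.

Lemma loc_inj_is_monoid_morphism : monoid_morphism loc_inj.
Proof.
split=> // a b; rewrite /loc_inj.
have -> : loc_mk a loc_denom1 * loc_mk b loc_denom1
  = loc_mul (loc_mk a loc_denom1) (loc_mk b loc_denom1) by [].
by rewrite loc_mulE; apply: mk_eq => /=; ring.
Qed.
HB.instance Definition _ :=
  GRing.isMonoidMorphism.Build A L loc_inj loc_inj_is_monoid_morphism.

End Localization.

(* -------------------------------------------------------------------- *)
Section TotalFractions.
Variable A : comNzRingType.

Definition regular_elt : {pred A} := fun a => `[< GRing.lreg a >].

Lemma regular_elt_mulr_closed : mulr_closed regular_elt.
Proof.
split=> [|a b]; first by apply/asboolP; apply: lreg1.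
by move=> /asboolP ra /asboolP rb; apply/asboolP; apply: lregM.
Qed.
HB.instance Definition _ :=
  GRing.isMulClosed.Build A regular_elt regular_elt_mulr_closed.

Lemma regular_elt0 : 0 \notin regular_elt.
Proof. by apply/negP => /asboolP/lreg_neq0; rewrite eqxx. Qed.

Definition total_fractions := loc_of regular_elt0.
HB.instance Definition _ := GRing.ComNzRing.on total_fractions.

Definition to_total_fractions : A -> total_fractions :=
  @loc_inj A regular_elt regular_elt0.
HB.instance Definition _ := GRing.RMorphism.on to_total_fractions.

End TotalFractions.

(* -------------------------------------------------------------------- *)
Section PrincipalQuotient.
Variables (A : comNzRingType) (f : A) (fNu : ~ exists g, g * f = 1).

(* The principal ideal (f), which is proper by fNu. *)
Definition principal_ideal of ~ (exists g, g * f = 1) : {pred A} :=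
  fun a => `[< exists g, a = g * f >].

Lemma principal_idealr_closed : idealr_closed (principal_ideal fNu).
Proof.
split.
- by apply/asboolP; exists 0; rewrite mul0r.
- by apply/negP => /asboolP[g e]; apply: fNu; exists g.
move=> a u v /asboolP[g ->] /asboolP[h ->]; apply/asboolP.
by exists (a * g + h); ring.
Qed.
HB.instance Definition _ :=
  isIdealr.Build A (principal_ideal fNu) principal_idealr_closed.

Definition principal_quot := {ideal_quot (principal_ideal fNu)}.
HB.instance Definition _ := GRing.ComNzRing.on principal_quot.

Definition to_principal_quot : A -> principal_quot := \pi_principal_quot.
HB.instance Definition _ := GRing.RMorphism.on to_principal_quot.

End PrincipalQuotient.

(* -------------------------------------------------------------------- *)
(* For K-subspaces W <= V of B, where B is a ring over K through iota :
   dim_K (V / W) = n, i.e. the classes modulo W of some b_0, ..., b_(n-1) in V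
   form a basis of V / W. *)
Definition quot_dim (K : fieldType) (B : comNzRingType)
    (iota : {rmorphism K -> B}) (V W : B -> Prop) (n : nat) : Prop :=
  exists b : 'I_n -> B, (forall i, V (b i)) /\
    forall z, V z ->
      exists! c : {ffun 'I_n -> K}, W (z - \sum_(i < n) iota (c i) * b i).

(* -------------------------------------------------------------------- *)
Section LocalRing.
Variables (K : fieldType) (n : nat) (x : 'I_n -> K).

Definition nonvanishing : {pred {mpoly K[n]}} := fun g => g.@[x] != 0.

Lemma nonvanishing_mulr_closed : mulr_closed nonvanishing.
Proof.
split=> [|g h]; rewrite !unfold_in; first by rewrite meval1 oner_neq0.
by move=> g0 h0; rewrite mevalM mulf_neq0.
Qed.
HB.instance Definition _ :=
  GRing.isMulClosed.Build {mpoly K[n]} nonvanishing nonvanishing_mulr_closed.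

Lemma nonvanishing0 : 0 \notin nonvanishing.
Proof. by rewrite unfold_in meval0 eqxx. Qed.

Definition local_ring := loc_of nonvanishing0.
HB.instance Definition _ := GRing.ComNzRing.on local_ring.

Definition to_local_ring : {mpoly K[n]} -> local_ring :=
  @loc_inj {mpoly K[n]} nonvanishing nonvanishing0.
HB.instance Definition _ := GRing.RMorphism.on to_local_ring.

Variables (f : {mpoly K[n]}) (fx : f.@[x] = 0).

Lemma to_local_ring_nonunit : ~ exists g, g * to_local_ring f = 1.
Proof.
case=> g; have [a [s ->]] := @loc_mk_ex _ _ nonvanishing0 g.
have -> : loc_mk nonvanishing0 a s * to_local_ring f
  = loc_mul (loc_mk nonvanishing0 a s)
            (loc_mk nonvanishing0 f (loc_denom1 nonvanishing)) by [].
rewrite loc_mulE => /loc_mkP[u uS] /= /(congr1 (meval x)).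
rewrite !mevalM !meval1 fx !(mulr0, mul0r, mul1r, mulr1) => /esym/eqP.
by rewrite mulf_eq0 (negPf uS) (negPf (valP s)).
Qed.

Definition local_curve_ring := principal_quot to_local_ring_nonunit.
HB.instance Definition _ := GRing.ComNzRing.on local_curve_ring.

Definition local_curve_fractions := total_fractions local_curve_ring.
HB.instance Definition _ := GRing.ComNzRing.on local_curve_fractions.

Definition to_local_curve_fractions :
    local_curve_ring -> local_curve_fractions :=
  @to_total_fractions local_curve_ring.
HB.instance Definition _ := GRing.RMorphism.on to_local_curve_fractions.

Definition scalar_to_fractions : K -> local_curve_fractions :=
  to_local_curve_fractions \o
    (to_principal_quot to_local_ring_nonunit \o (to_local_ring \o @mpolyC n K)).
HB.instance Definition _ := GRing.RMorphism.on scalar_to_fractions.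

End LocalRing.

Arguments to_local_curve_fractions [K n x f] fx _.
Arguments scalar_to_fractions [K n x f] fx _.

(* delta_x(f) = d; in particular x lies on the curve f = 0. *)
Definition delta_invariant (K : fieldType) (f : {mpoly K[2]}) (x : 'I_2 -> K)
    (d : nat) : Prop :=
  exists fx : f.@[x] = 0,
    quot_dim (scalar_to_fractions fx)
      (integralOver (to_local_curve_fractions fx))
      (fun z => exists a, z = to_local_curve_fractions fx a) d.

(* -------------------------------------------------------------------- *)
Definition translate (R : nzRingType) (n : nat) (f : {mpoly R[n]})
    (x : 'I_n -> R) : {mpoly R[n]} :=
  f \mPo [tuple (x i)%:MP + 'X_i | i < n].

(* Order of vanishing of f at x; it is a junk value for f = 0. *)
Definition multiplicity (R : nzRingType) (n : nat) (f : {mpoly R[n]})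
    (x : 'I_n -> R) : nat :=
  let g := translate f x in \big[minn/msize g]_(k <- msupp g) mdeg k.

Definition initial_form (R : nzRingType) (n : nat) (f : {mpoly R[n]})
    (x : 'I_n -> R) : {mpoly R[n]} :=
  pihomog mdeg (multiplicity f x) (translate f x).

Definition hessian (R : nzRingType) (n : nat) (f : {mpoly R[n]})
    (x : 'I_n -> R) : 'M[R]_n :=
  \matrix_(i, j) (f^`M(j)^`M(i)).@[x].

Definition pt2 (R : Type) (a b : R) : 'I_2 -> R := tnth [tuple a; b].

Section SosInvariant.
Variable R : realType.
Implicit Types (f g : {mpoly R[2]}) (x : 'I_2 -> R).

Definition ordinary_singularity f x : Prop :=
  multiplicity f x = 2 /\ hessian f x \in unitmx.

(* P^1(R) is encoded as option R: Some c is [c : 1] and None is [1 : 0]. *)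
Definition real_inf_near f x (t : option R) : Prop :=
  (initial_form f x).@[if t is Some c then pt2 c 1 else pt2 1 0] = 0.

Local Notation u := ('X_(0 : 'I_2) : {mpoly R[2]}).
Local Notation v := ('X_(1 : 'I_2) : {mpoly R[2]}).

(* g is the strict transform of f in the chart around t of the blowing-up of
   x, that is, g = f(a + uv, b + v) / v^m or g = f(a + u, b + uv) / u^m. *)
Definition strict_transform f x (t : option R) g : Prop :=
  let a := (x 0)%:MP in
  let b := (x 1)%:MP in
  let m := multiplicity f x in
  if t is Some _ then v ^+ m * g = f \mPo [tuple a + u * v; b + v]
  else u ^+ m * g = f \mPo [tuple a + u; b + u * v].

Definition inf_near_point (t : option R) : 'I_2 -> R :=
  if t is Some c then pt2 c 0 else pt2 0 0.

(* sos_invariant f x q : the recursion for delta^sos_x(f) terminates, with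
   value q. *)
Inductive sos_invariant : {mpoly R[2]} -> ('I_2 -> R) -> rat -> Prop :=
| SosOrdinary f x of ordinary_singularity f x : sos_invariant f x 1
| SosBlowup f x (s : seq (option R)) (f' : option R -> {mpoly R[2]})
    (q : option R -> rat) of
    ~ ordinary_singularity f x &
    uniq s & (forall t, t \in s <-> real_inf_near f x t) &
    (forall t, t \in s -> strict_transform f x t (f' t)) &
    (forall t, t \in s -> sos_invariant (f' t) (inf_near_point t) (q t)) :
    sos_invariant f x ((multiplicity f x)%:R ^+ 2 / 4 + \sum_(t <- s) q t).

End SosInvariant.

(* -------------------------------------------------------------------- *)
(* Points of the projective plane are given by homogeneous coordinates
   X : 'I_3 -> R; the charts are the standard ones, X k != 0. *)
Section Projective.
Variable R : realType.

Definition dehomogenize (k : 'I_3) (P : {mpoly R[3]}) : {mpoly R[2]} :=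
  P \mPo [tuple (if unlift k i is Some j then 'X_j else 1) | i < 3].

Definition affine_point (k : 'I_3) (X : 'I_3 -> R) : 'I_2 -> R :=
  fun j => X (lift k j) / X k.

Definition nonneg_form (d : nat) (P : {mpoly R[3]}) : Prop :=
  P \is d.-homog /\ forall Y : 'I_3 -> R, 0 <= P.@[Y].

(* [X] is isolated in the zero set of P in P^2(R). The images of the balls
   around X != 0 form a basis of neighbourhoods of [X] in P^2(R), and the zeros
   Y with [Y] = [X] are the multiples of X. *)
Definition isolated_real_zero (P : {mpoly R[3]}) (X : 'I_3 -> R) : Prop :=
  P.@[X] = 0 /\
  exists2 e : R, 0 < e &
    forall Y : 'I_3 -> R, (forall i, `|Y i - X i| < e) -> P.@[Y] = 0 ->
      exists c : R, forall i, Y i = c * X i.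

End Projective.

Definition complexify (R : realType) (n : nat) (p : {mpoly R[n]}) :
    {mpoly R[i][n]} :=
  map_mpoly (real_complex R) p.

Definition complex_point (R : realType) (n : nat) (x : 'I_n -> R) :
    'I_n -> R[i] :=
  fun i => real_complex R (x i).

(* Main.v *)
From HB Require Import structures.
Require Import Defs.
From mathcomp Require Import all_boot all_order all_algebra.
From mathcomp Require Import ring lra boolp.
From mathcomp Require Import reals complex mpoly.
Set Implicit Arguments.
Unset Strict Implicit.
Unset Printing Implicit Defensive.
Import Order.TTheory GRing.Theory Num.Theory.
Local Open Scope ring_scope.

(** Why the two invariants agree.  The dehomogenization [f] has an isolated
    minimum at the point, of multiplicity two, so its quadratic part is positive
    semidefinite and nonzero.  If that part is definite the point is ordinary.
    Otherwise it is the square of a real linear form, there is exactly one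
    real infinitely near point, and the strict transform again has an isolated
    minimum of multiplicity two there: the square of the coordinate transverse
    to the exceptional line keeps its positive coefficient.  The recursion is
    therefore a chain of some length [n], every link contributes
    [2 ^ 2 / 4 = 1], and the value is [n].

    Composing the blowing-ups backwards shows that, for some polynomial [phi],
    the function [f (a + phi(y) + y^n x, b + y)] is [y^(2n)] times a polynomial
    whose restriction to [y = 0] is a positive definite quadratic polynomial
    ([contact]).  Expanding in powers of [x] turns this into
    [f = E xi^2 + b1 xi eta^n + b0 eta^(2n)] for a local coordinate system
    [(xi, eta)], with [E] a unit and a discriminant that does not vanish
    ([contact_normal_form]): over the complex numbers the curve consists of two
    smooth branches having contact of order [n].

    For such a curve delta is computed directly.  In the total ring of fractions
    of the local ring [A] put [u = xi / eta^n].  It is a root of a monic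
    quadratic polynomial over [A] whose reduction has two distinct roots, so
    that [eta (A + A u)] is a radical ideal; since every regular element of [A]
    divides a power of [eta], this makes [A + A u] the integral closure of [A].
    Modulo [A] it has the basis [u, eta u, ..., eta^(n-1) u], whence
    delta equals [n] ([quot_dim_normalization], [delta_normal_form]).

    The recursion terminates by a Lojasiewicz inequality on the polar curve:
    where the derivative of [f] along [x] vanishes, [f] is at least
    [C |y - b|^N] ([crit_bound]).  Such a bound exists because [f] satisfies an
    algebraic equation over the polynomials in [y] modulo its derivative; a
    blowing-up lowers [N] by two, while [N < 2] is impossible.

    The tangent direction may be horizontal, which calls for the other chart,
    and the chain may change charts later on.  The contact is then measured
    after exchanging the coordinates, and the two ways of counting are compared
    through the uniqueness of delta ([contact_swap_eq]). *)

Local Notation X := ('X_(0 : 'I_2)).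
Local Notation Y := ('X_(1 : 'I_2)).
Local Notation comp2 p q := (comp_mpoly [tuple p; q]).

(** * Polynomials in two variables *)

Lemma mpoly2_ind (K : comNzRingType) (P : {mpoly K[2]} -> Prop) :
  (forall c, P c%:MP) -> P X -> P Y ->
  (forall g h, P g -> P h -> P (g + h)) ->
  (forall g h, P g -> P h -> P (g * h)) -> forall g, P g.
Proof.
move=> PC PX PY PD PM; apply: mpolyind => [|c m g _ _ Pg]; first exact: (PC 0).
apply: PD => //; rewrite -mul_mpolyC mpolyXE_id; apply: (PM) => //.
apply: big_ind => [||i _]; [exact: (PC 1)|exact: (PM)|].
elim: (m i) => [|k IH]; rewrite ?expr0 ?exprS; first exact: (PC 1).
apply: (PM) => //; have [->//|->//] : i = 0 \/ i = 1.
by case: i {IH} => [[|[|//]] ?]; [left|right]; apply: val_inj.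
Qed.

Lemma mpoly2_ext (K S : comNzRingType) (F G : {rmorphism {mpoly K[2]} -> S}) :
  (forall c, F c%:MP = G c%:MP) -> F X = G X -> F Y = G Y -> F =1 G.
Proof.
move=> eC eX eY; apply: mpoly2_ind => // g h eg eh.
  by rewrite !rmorphD eg eh.
by rewrite !rmorphM eg eh.
Qed.

Section Comp.
Variable K : comNzRingType.
Implicit Types f g p q r s : {mpoly K[2]}.

Lemma comp2X p q : comp2 p q X = p.
Proof. by rewrite comp_mpolyXU -tnth_nth. Qed.
Lemma comp2Y p q : comp2 p q Y = q.
Proof. by rewrite comp_mpolyXU -tnth_nth. Qed.
Lemma comp2M p q f g : comp2 p q (f * g) = comp2 p q f * comp2 p q g.
Proof. exact: rmorphM. Qed.
Lemma comp2Xn p q f n : comp2 p q (f ^+ n) = comp2 p q f ^+ n.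
Proof. exact: rmorphXn. Qed.
Definition comp2E := (comp_mpoly0, comp_mpoly1, comp2X, comp2Y, comp_mpolyC,
  comp_mpolyD, comp_mpolyB, comp_mpolyN, comp2M, comp2Xn).

Lemma meval2X (a b : K) : X.@[pt2 a b] = a.
Proof. by rewrite mevalXU. Qed.
Lemma meval2Y (a b : K) : Y.@[pt2 a b] = b.
Proof. by rewrite mevalXU. Qed.
Lemma meval2Xn x f n : (f ^+ n).@[x] = f.@[x] ^+ n.
Proof. exact: rmorphXn. Qed.
Definition meval2E := (meval2X, meval2Y, mevalC, mevalD, mevalB, mevalN,
  mevalM, meval2Xn, meval0, meval1).

Lemma comp2A f p q r s :
  comp2 r s (comp2 p q f) = comp2 (comp2 r s p) (comp2 r s q) f.
Proof.
by apply: (mpoly2_ext (F := comp2 r s \o comp2 p q)) => [c||] /=;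
  rewrite !comp2E.
Qed.

Lemma comp2_swap f p q : comp2 p q (comp2 Y X f) = comp2 q p f.
Proof. by rewrite comp2A !comp2E. Qed.

Lemma comp2_id f : comp2 X Y f = f.
Proof. by apply: (mpoly2_ext (G := idfun)) => [c||] /=; rewrite !comp2E. Qed.

Lemma meval_comp2 f p q x :
  (comp2 p q f).@[x] = f.@[pt2 p.@[x] q.@[x]].
Proof.
by apply: (mpoly2_ext (F := meval x \o comp2 p q) (G := meval _)) => [c||] /=;
  rewrite !comp2E !meval2E.
Qed.

Lemma mpoly2_divX f : exists g, f = comp2 0 Y f + X * g.
Proof.
move: f; apply: mpoly2_ind => [c|||f g [f1 ef] [g1 eg]|f g [f1 ef] [g1 eg]].
- by exists 0; rewrite comp2E mulr0 addr0.
- by exists 1; rewrite comp2E mulr1 add0r.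
- by exists 0; rewrite comp2E mulr0 addr0.
- by exists (f1 + g1); rewrite {1}ef {1}eg comp2E; ring.
exists (comp2 0 Y f * g1 + f1 * comp2 0 Y g + X * f1 * g1).
by rewrite {1}ef {1}eg comp2E; ring.
Qed.

Lemma mpoly2_divY f : exists g, f = comp2 X 0 f + Y * g.
Proof.
have [g e] := mpoly2_divX (comp2 Y X f); exists (comp2 Y X g).
move/(congr1 (comp2 Y X)): e.
by rewrite !(comp2A, comp2E) comp2_id.
Qed.

Lemma comp2_00 f : comp2 0 0 f = (f.@[pt2 0 0])%:MP :> {mpoly K[2]}.
Proof.
by apply: (mpoly2_ext (F := comp2 0 0) (G := @mpolyC 2 K \o meval (pt2 0 0)))
  => [c||] /=; rewrite ?comp2E !meval2E.
Qed.

Lemma mpoly2_split0 f : exists g h, f = (f.@[pt2 0 0])%:MP + X * g + Y * h.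
Proof.
have [g e] := mpoly2_divX f; have [h e'] := mpoly2_divY (comp2 0 Y f).
exists g, h; rewrite {1}e {1}e' -comp2_00 comp2A !comp2E; ring.
Qed.

Lemma mderivU (i j : 'I_2) : ('X_j : {mpoly K[2]})^`M(i) = ((i == j)%:R)%:MP.
Proof.
rewrite mderivX mnmE eq_sym; case: eqP => [->|_]; last by rewrite scale0r mpolyC0.
by rewrite -{1}[U_(j)%MM]add0m addmK mpolyX0 scale1r.
Qed.

End Comp.

(** * The integral closure of a curve with two branches in contact *)

(** The data are those of the local ring [A] of the curve
    [E xi^2 + b1 xi eta^n + b0 eta^(2n) = 0], where [E] is a unit and
    [E (z - c1) (z - c2)] is the reduction of [E z^2 + b1 z + b0] modulo the
    maximal ideal [(xi, eta)].  [syzygy] holds because the equation of the curve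
    lies in the square of the ideal [(xi, eta^n)], and [eta_frac] says that
    inverting [eta] yields the total ring of fractions. *)
Section TwoBranches.
Variables (K : fieldType) (A T : comNzRingType).
Variables (iA : {rmorphism K -> A}) (j : {rmorphism A -> T}).
Hypothesis j_inj : injective j.
Hypothesis j_unit : forall s, GRing.lreg s -> exists t, j s * t = 1.
Hypothesis j_frac : forall z, exists s a, GRing.lreg s /\ j s * z = j a.

Variables (n : nat) (xi eta E E' b1 b0 : A) (c1 c2 : K).
Hypothesis n_gt0 : (0 < n)%N.
Hypothesis c12 : c1 != c2.
Hypothesis EE' : E * E' = 1.
Hypothesis curve_eq :
  E * xi ^+ 2 + b1 * xi * eta ^+ n + b0 * eta ^+ n ^+ 2 = 0.
Hypothesis b1E :
  exists p q, b1 = - (E * iA (c1 + c2)) + eta * p + xi * q.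
Hypothesis b0E : exists p q, b0 = E * iA (c1 * c2) + eta * p + xi * q.
Hypothesis residue : forall a, exists c p q, a = iA c + eta * p + xi * q.
Hypothesis eta_reg : GRing.lreg eta.
Hypothesis syzygy : forall a b, a * eta ^+ n + b * xi = 0 ->
  (exists p q, a = eta ^+ n * p + xi * q) /\
  (exists p q, b = eta ^+ n * p + xi * q).
Hypothesis eta_free : forall m (c : 'I_m -> K) p q, (m <= n)%N ->
  \sum_(i < m) iA (c i) * eta ^+ i = eta ^+ m * p + xi * q ->
  forall i, c i = 0.
Hypothesis eta_frac : forall s, GRing.lreg s -> exists k b, eta ^+ k = s * b.

Section AdjoinQuotient.
Variable h : T.
Hypothesis eta_h : j eta * h = 1.
Let u := j xi * h ^+ n.

Let jeta_reg : GRing.lreg (j eta).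
Proof.
by move=> x y e; rewrite -[x]mul1r -[y]mul1r -eta_h mulrAC e mulrAC.
Qed.

Let uE : j eta ^+ n * u = j xi.
Proof. by rewrite /u mulrCA -exprMn eta_h expr1n mulr1. Qed.

Let B z := exists p q, z = j p + j q * u.

(** Dividing the equation of the curve by [E eta^(2n)]. *)
Let usqr : u ^+ 2 = - (j (E' * b1) * u + j (E' * b0)).
Proof.
have /(congr1 (fun x => x * h ^+ n ^+ 2)) : j (E' *
   (E * xi ^+ 2 + b1 * xi * eta ^+ n + b0 * eta ^+ n ^+ 2)) = 0.
  by rewrite curve_eq mulr0 rmorph0.
rewrite mul0r => e; apply/eqP; rewrite -subr_eq0 opprK -[X in _ == X]e; apply/eqP.
have hn : j eta ^+ n * h ^+ n = 1 by rewrite -exprMn eta_h expr1n.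
have jE : j E * j E' = 1 by rewrite -rmorphM EE' rmorph1.
rewrite /u !(rmorphD, rmorphM, rmorphXn).
transitivity ((j E * j E') * (j xi * h ^+ n) ^+ 2
   + j E' * j b1 * (j xi * h ^+ n) * (j eta ^+ n * h ^+ n)
   + j E' * j b0 * (j eta ^+ n * h ^+ n) ^+ 2); last by ring.
by rewrite jE hn; ring.
Qed.

Let Bj a : B (j a). Proof. by exists a, 0; rewrite rmorph0 mul0r addr0. Qed.
Let Bu : B u. Proof. by exists 0, 1; rewrite rmorph0 rmorph1; ring. Qed.
Let BD x y : B x -> B y -> B (x + y).
Proof.
move=> [p [q ->]] [p' [q' ->]]; exists (p + p'), (q + q').
by rewrite !rmorphD; ring.
Qed.
Let BM x y : B x -> B y -> B (x * y).
Proof.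
move=> [p [q ->]] [p' [q' ->]].
exists (p * p' - q * q' * (E' * b0)), (p * q' + q * p' - q * q' * (E' * b1)).
transitivity (j p * j p' + (j p * j q' + j q * j p') * u + j q * j q' * u ^+ 2);
  first by ring.
by rewrite usqr !(rmorphD, rmorphB, rmorphM); ring.
Qed.
Let BN x : B x -> B (- x).
Proof. by move=> Bx; rewrite -mulN1r -(rmorph1 j) -rmorphN; apply: BM. Qed.
Let BX x m : B x -> B (x ^+ m).
Proof.
move=> Bx; elim: m => [|m IH]; first by rewrite expr0 -(rmorph1 j).
by rewrite exprS; apply: BM.
Qed.
Let I z := exists2 b, B b & z = j eta * b.
Let ID x y : I x -> I y -> I (x + y).
Proof.
by move=> [b Bb ->] [b' Bb' ->]; exists (b + b'); [exact: BD|rewrite mulrDr].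
Qed.
Let IM x y : B x -> I y -> I (x * y).
Proof. by move=> Bx [b Bb ->]; exists (x * b); [exact: BM|rewrite mulrCA]. Qed.
Let IN x : I x -> I (- x).
Proof. by move=> [b Bb ->]; exists (- b); [exact: BN|rewrite mulrN]. Qed.
Let Isum (J : Type) (r : seq J) (P : pred J) (F : J -> T) :
  (forall i, P i -> I (F i)) -> I (\sum_(i <- r | P i) F i).
Proof.
move=> BF; apply: big_ind => //.
by exists 0; rewrite ?mulr0 // -(rmorph0 j).
Qed.
Let Ixi : I (j xi).
Proof.
exists (j eta ^+ n.-1 * u); first by apply: BM; rewrite // -rmorphXn.
by rewrite mulrA -exprS prednK // uE.
Qed.
Let Ieta : I (j eta).
Proof. by exists 1; rewrite ?mulr1 // -(rmorph1 j). Qed.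
Let Im p q : I (j (eta * p + xi * q)).
Proof.
by rewrite rmorphD !rmorphM (mulrC (j eta)) (mulrC (j xi)); apply: ID; apply: IM.
Qed.

Let const_eq0 c p q : iA c = eta * p + xi * q -> c = 0.
Proof.
move=> e; apply: (@eta_free 1%N (fun=> c) p q n_gt0 _ ord0).
by rewrite big_ord1 expr0 mulr1 expr1.
Qed.

(** The ring [B] modulo [eta B] is two-dimensional over the residue field: a
    relation between [1] and [u], multiplied by [eta^n], is a syzygy of
    [eta^n] and [xi]. *)
Let I_free r0 r1 : I (j (iA r0) + j (iA r1) * u) -> r0 = 0 /\ r1 = 0.
Proof.
move=> [_ [p [q ->]] e].
have : (iA r0 - eta * p) * eta ^+ n + (iA r1 - eta * q) * xi = 0.
  apply: j_inj; rewrite rmorph0 rmorphD !rmorphM !rmorphB !rmorphM rmorphXn -uE.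
  transitivity (j eta ^+ n * ((j (iA r0) + j (iA r1) * u)
    - j eta * (j p + j q * u))); first by ring.
  by rewrite e subrr mulr0.
have en : eta ^+ n = eta * eta ^+ n.-1 by rewrite -exprS prednK.
case/syzygy => -[p0 [q0 e0]] [p1 [q1 e1]]; split.
  apply: (@const_eq0 _ (eta ^+ n.-1 * p0 + p) q0).
  by move/(congr1 (+%R^~ (eta * p))): e0; rewrite subrK en => ->; ring.
apply: (@const_eq0 _ (eta ^+ n.-1 * p1 + q) q1).
by move/(congr1 (+%R^~ (eta * q))): e1; rewrite subrK en => ->; ring.
Qed.

Let IE' x : I (j E * x) -> I x.
Proof.
move=> Ix; have -> : x = j E' * (j E * x).
  by rewrite mulrA -rmorphM [E' * E]mulrC EE' rmorph1 mul1r.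
exact: IM.
Qed.

Let quad : I ((u - j (iA c1)) * (u - j (iA c2))).
Proof.
apply: IE'.
have [p [q e]] := b1E; have [p' [q' e']] := b0E.
have -> : j E * ((u - j (iA c1)) * (u - j (iA c2)))
  = - (j (eta * p + xi * q) * u + j (eta * p' + xi * q')).
  have E2 : j E * u ^+ 2 = - (j b1 * u + j b0).
    by rewrite usqr mulrN mulrDr mulrA -!rmorphM !mulrA EE' !mul1r.
  transitivity (j E * u ^+ 2 - j E * (j (iA c1) + j (iA c2)) * u
     + j E * (j (iA c1) * j (iA c2))); first by ring.
  rewrite E2 e e' !(rmorphD, rmorphN, rmorphM); ring.
apply: IN; apply: ID; last exact: Im.
by rewrite mulrC; apply: IM.
Qed.

(** Modulo [eta B], the element [u - d] is an eigenvector of multiplication by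
    [u] with eigenvalue [c], so that [p(u)^m (u - d) = p(c)^m (u - d)] for
    [p(u) = r0 + r1 u]. *)
Let char_eq0 (c d : K) r0 r1 m :
  I ((u - j (iA c)) * (u - j (iA d))) ->
  I ((j (iA r0) + j (iA r1) * u) ^+ m) -> r0 + r1 * c = 0.
Proof.
move=> Icd Im'.
have : I (j (iA ((r0 + r1 * c) ^+ m)) * (u - j (iA d))).
  have [y By e] : exists2 y, B y & j (iA ((r0 + r1 * c) ^+ m)) =
      (j (iA r0) + j (iA r1) * u) ^+ m + y * (u - j (iA c)).
    elim: m {Im'} => [|m [y By IH]].
      by exists 0; rewrite ?expr0 ?rmorph1 ?mul0r ?addr0 // -(rmorph0 j).
    exists ((j (iA r0) + j (iA r1) * u) * y
             - j (iA ((r0 + r1 * c) ^+ m)) * j (iA r1)).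
      apply: BD; last by apply/BN/BM.
      by apply: BM => //; apply: BD => //; apply: BM.
    rewrite [in LHS]exprS rmorphM rmorphM [in LHS]IH.
    rewrite [in X in _ = _ + X]IH !(rmorphD, rmorphM) [in RHS]exprS; ring.
  rewrite e mulrDl; apply: ID.
    by rewrite mulrC; apply: IM => //; apply: BD => //; apply: BN.
  by rewrite -mulrA; apply: IM.
rewrite mulrBr -rmorphM -rmorphM -rmorphN -rmorphN addrC => /I_free[_] /eqP.
by rewrite expf_eq0 => /andP[_ /eqP].
Qed.

(** Here the branches have to be distinct: [B / eta B] is a product of two copies
    of the residue field, so it has no nilpotents. *)
Let I_reduced w m : B w -> I (w ^+ m) -> I w.
Proof.
move=> [p [q ew]] Iwm.
have [p0 [pp [pq ep]]] := residue p; have [q0 [qp [qq eq]]] := residue q.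
have [x Ix ex] : exists2 x, I x & w = (j (iA p0) + j (iA q0) * u) + x.
  exists (j (eta * pp + xi * pq) + u * j (eta * qp + xi * qq)).
    by apply: ID; rewrite // ; apply: IM.
  by rewrite ew ep eq !rmorphD; ring.
have Br : B (j (iA p0) + j (iA q0) * u) by apply: BD => //; apply: BM.
have IBI z : I z -> B z by move=> [b Bb ->]; apply: BM.
have Irm : I ((j (iA p0) + j (iA q0) * u) ^+ m).
  have [y By ->] : exists2 y, B y & (j (iA p0) + j (iA q0) * u) ^+ m
      = w ^+ m + y * x.
    rewrite ex; elim: m {Iwm} => [|m [y By IH]].
      by exists 0; rewrite ?mul0r ?addr0 // -(rmorph0 j).
    exists ((j (iA p0) + j (iA q0) * u) * y
       - (j (iA p0) + j (iA q0) * u + x) ^+ m).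
      apply: BD; first exact: BM.
      by apply/BN/BX/BD => //; apply: IBI.
    by rewrite [in LHS]exprS IH !exprS; ring.
  by apply: ID => //; apply: IM.
have quad' : I ((u - j (iA c2)) * (u - j (iA c1))) by rewrite mulrC.
have e1 := char_eq0 quad Irm; have e2 := char_eq0 quad' Irm.
have q00 : q0 = 0.
  have /eqP : q0 * (c1 - c2) = 0.
    by rewrite mulrBr -[q0 * c1](addKr p0) e1 -[q0 * c2](addKr p0) e2 subrr.
  by rewrite mulf_eq0 subr_eq0 (negPf c12) orbF => /eqP.
have p00 : p0 = 0 by move: e1; rewrite q00 mul0r addr0.
by rewrite ex p00 q00 !rmorph0 mul0r !add0r.
Qed.

(** If [w = eta^(k+1) z] with [z] integral, an equation of [z] multiplied by
    [eta^((k+1) m)] puts [w^m] into [eta B], hence [w] itself, and one power of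
    [eta] can be cancelled. *)
Let integral_descent z k : integralOver j z -> B (j eta ^+ k * z) -> B z.
Proof.
move=> [p mon_p pz0]; elim: k => [|k IH]; first by rewrite expr0 mul1r.
set w := j eta ^+ k.+1 * z => Bw; apply: IH.
have [b Bb e] : I w.
  apply: (@I_reduced _ (size p).-1 Bw).
  have sp : (size p).-1.+1 = size p by rewrite prednK // size_poly_gt0 monic_neq0.
  have := rootP pz0.
  rewrite horner_coef size_map_poly_id0; last first.
    by rewrite (monicP mon_p) rmorph1 oner_neq0.
  rewrite -sp big_ord_recr /= coef_map /= -lead_coefE (monicP mon_p) rmorph1 mul1r.
  move/eqP; rewrite addrC addr_eq0 => /eqP e.
  rewrite exprMn e.
  rewrite mulrN mulr_sumr; apply/IN/Isum => i _.
  have -> : j eta ^+ k.+1 ^+ (size p).-1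
     = j eta ^+ k.+1 ^+ ((size p).-1 - i) * j eta ^+ k.+1 ^+ i.
    by rewrite -exprD subnK // ltnW.
  rewrite coef_map /=.
  have -> : j eta ^+ k.+1 ^+ ((size p).-1 - i) * j eta ^+ k.+1 ^+ i
     * (j p`_i * z ^+ i) = j p`_i * w ^+ i
     * (j eta ^+ k.+1) ^+ ((size p).-1 - i) by rewrite /w exprMn; ring.
  have -> : ((size p).-1 - i)%N = ((size p).-1 - i).-1.+1.
    by rewrite prednK // subn_gt0.
  rewrite exprSr mulrA [j eta ^+ _.+1]exprSr mulrA; apply: IM => //.
  rewrite -rmorphXn; apply: (BM) => //; apply: BM; last first.
    by apply: BX; rewrite -rmorphM.
  by apply: BM => //; apply: BX.
suff -> : j eta ^+ k * z = b by [].
by apply: jeta_reg; rewrite -e /w exprS mulrA.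
Qed.

Let integral_B z : integralOver j z <-> B z.
Proof.
split=> [iz|[p [q ->]]].
  have [s [a [rs e]]] := j_frac z; have [k [b eb]] := eta_frac rs.
  apply: (@integral_descent _ k iz).
  by rewrite -rmorphXn eb mulrC rmorphM mulrA [z * _]mulrC e -rmorphM.
have iu : integralOver j u.
  exists ('X^2 + (E' * b1)%:P * 'X + (E' * b0)%:P).
    rewrite -addrA monicE lead_coefDl ?lead_coefXn // size_polyXn.
    rewrite (leq_ltn_trans (size_polyD _ _)) // gtn_max.
    rewrite (leq_ltn_trans (size_polyC_leq1 _)) // andbT.
    rewrite (leq_ltn_trans (size_polyMleq _ _)) // size_polyX addn2 /=.
    by rewrite ltnS ltnS size_polyC_leq1.
  rewrite /root !rmorphD /= map_polyXn (rmorphM _ (E' * b1)%:P) /= map_polyX !map_polyC /=.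
  move: (u) (usqr) => v ev; rewrite !hornerE ev; apply/eqP; ring.
apply: integral_add; first exact: integral_id.
by apply: integral_mul => //; exact: integral_id.
Qed.

Let digits q m : (m <= n)%N -> exists (c : 'I_m -> K) p r,
  q = \sum_(i < m) iA (c i) * eta ^+ i + eta ^+ m * p + xi * r.
Proof.
elim: m => [|m IH] mn.
  by exists (fun=> 0), q, 0; rewrite big_ord0 expr0; ring.
have [c [p [r e]]] := IH (ltnW mn); have [d [p' [r' e']]] := residue p.
exists (fun i => if unlift ord_max i is Some i' then c i' else d), p',
  (r + eta ^+ m * r').
have wl i : widen_ord (leqnSn m) i = lift ord_max i.
  by apply: val_inj; rewrite /= /bump leqNgt ltn_ord.
rewrite big_ord_recr /= unlift_none.
under eq_bigr => i _ do rewrite wl liftK.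
by rewrite e e' exprS; ring.
Qed.

Let jxiu : exists a, j xi * u = j a.
Proof.
exists (- (E' * b1 * xi + E' * b0 * eta ^+ n)).
rewrite -uE -mulrA -expr2 usqr rmorphN rmorphD [j (_ * xi)]rmorphM -uE.
by rewrite [j (_ * _ ^+ n)]rmorphM rmorphXn; ring.
Qed.

Lemma quot_dim_adjoin_quotient (iT : {rmorphism K -> T}) : (forall c, iT c = j (iA c)) ->
  quot_dim iT (integralOver j) (fun z => exists a, z = j a) n.
Proof.
move=> iTE; exists (fun i => j eta ^+ i * u); split.
  by move=> i; apply/integral_B; rewrite -rmorphXn; apply: BM.
move=> _ /integral_B[p [q ->]].
have [c [p' [r eq]]] := digits q (leqnn n); have [a ea] := jxiu.
have [d ed] : exists d, j q * u = j d + \sum_(i < n) iT (c i) * (j eta ^+ i * u).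
  exists (xi * p' + r * a); rewrite eq !rmorphD rmorph_sum mulrDl mulrDl mulr_suml.
  rewrite -[LHS]addrA addrC; congr (_ + _); last first.
    by apply: eq_bigr => i _; rewrite rmorphM rmorphXn iTE mulrA.
  by rewrite !rmorphM -ea rmorphXn -uE; ring.
exists [ffun i => c i]; split.
  exists (p + d); rewrite ed rmorphD.
  under [X in _ - X]eq_bigr => i _ do rewrite ffunE.
  by ring.
move=> c' [a' ea']; apply/ffunP => i; rewrite ffunE; apply/eqP.
rewrite -subr_eq0; apply/eqP; move: i.
have : (d + p - a') * eta ^+ n
   + (\sum_(i < n) iA (c i - c' i) * eta ^+ i) * xi = 0.
  apply: j_inj; rewrite rmorph0 rmorphD !rmorphM rmorphB -ea' rmorphD ed.
  have -> : j (\sum_(i < n) iA (c i - c' i) * eta ^+ i)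
    = \sum_(i < n) (iT (c i) - iT (c' i)) * j eta ^+ i.
    rewrite rmorph_sum; apply: eq_bigr => i _.
    by rewrite rmorphM rmorphXn rmorphB rmorphB !iTE.
  have -> : \sum_(i < n) (iT (c i) - iT (c' i)) * j eta ^+ i
    = \sum_(i < n) iT (c i) * j eta ^+ i - \sum_(i < n) iT (c' i) * j eta ^+ i.
    by rewrite -sumrB; apply: eq_bigr => i _; rewrite mulrBl.
  rewrite rmorphXn -uE.
  have su (c0 : 'I_n -> K) : \sum_(i < n) iT (c0 i) * (j eta ^+ i * u)
     = (\sum_(i < n) iT (c0 i) * j eta ^+ i) * u.
    by rewrite mulr_suml; apply: eq_bigr => i _; rewrite mulrA.
  by rewrite !su; ring.
by case/syzygy => _ [p0 [q0 e0]]; apply: (eta_free (leqnn n) e0).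
Qed.

End AdjoinQuotient.

Theorem quot_dim_normalization (iT : {rmorphism K -> T}) :
  (forall c, iT c = j (iA c)) ->
  quot_dim iT (integralOver j) (fun z => exists a, z = j a) n.
Proof.
by have [h eta_h] := j_unit eta_reg; apply: (quot_dim_adjoin_quotient eta_h).
Qed.

End TwoBranches.

(** * The local ring of a plane curve *)

Section CoordinateSyzygies.
Variable K : fieldType.
Implicit Types a b : {mpoly K[2]}.

Lemma mpolyX_neq0 (i : 'I_2) : 'X_i != 0 :> {mpoly K[2]}.
Proof. by rewrite -msize_poly_eq0 msizeX. Qed.

Lemma syzygyXY a b : Y * a = X * b -> exists2 k, b = Y * k & a = X * k.
Proof.
move=> e; have [k ek] := mpoly2_divY b.
have /(congr1 (comp2 X 0)) := e.
rewrite !comp2E mul0r => /esym/eqP; rewrite mulf_eq0 (negPf (mpolyX_neq0 _)) /=.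
move=> /eqP b0; exists k; first by rewrite ek b0 add0r.
apply: (mulfI (mpolyX_neq0 1)); rewrite e ek b0; ring.
Qed.

Lemma syzygyXYn n a b :
  Y ^+ n * a = X * b -> exists2 k, b = Y ^+ n * k & a = X * k.
Proof.
elim: n a b => [|n IH] a b; first by rewrite expr0 !mul1r; exists b; rewrite ?mul1r.
rewrite exprSr -mulrA => /IH[k -> /syzygyXY[k' -> ->]].
by exists k'; rewrite ?mulrA.
Qed.
End CoordinateSyzygies.

Section Bivariate.
Variable K : fieldType.

(** Univariate division is applied to [{poly {poly K}}], with the second variable
    inside the coefficients. *)
Definition poly_in_Y : {poly K} -> {mpoly K[2]} :=
  horner_eval (Y : {mpoly K[2]}) \o map_poly (@mpolyC 2 K).
HB.instance Definition _ := GRing.RMorphism.on poly_in_Y.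

Definition bivar : {poly {poly K}} -> {mpoly K[2]} :=
  horner_eval (X : {mpoly K[2]}) \o map_poly poly_in_Y.
HB.instance Definition _ := GRing.RMorphism.on bivar.

Lemma bivarC c : bivar c%:P = poly_in_Y c.
Proof. by rewrite /bivar /= map_polyC /horner_eval hornerC. Qed.

Lemma poly_in_YX : poly_in_Y 'X = Y.
Proof. by rewrite /poly_in_Y /= map_polyX /horner_eval hornerX. Qed.

Lemma poly_in_YC c : poly_in_Y c%:P = c%:MP.
Proof. by rewrite /poly_in_Y /= map_polyC /horner_eval hornerC. Qed.

Lemma meval_poly_in_Y D s t : (poly_in_Y D).@[pt2 s t] = D.[t].
Proof.
rewrite /poly_in_Y /= /horner_eval -[X in _ = _.[X]](meval2Y s t).
rewrite -horner_map /= -map_poly_comp /=.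
by rewrite map_poly_id // => c _ /=; rewrite mevalC.
Qed.

Lemma meval_bivar (Q : {poly {poly K}}) s t :
  (bivar Q).@[pt2 s t] = (map_poly (horner_eval t) Q).[s].
Proof.
rewrite /bivar /= /horner_eval -[in RHS](meval2X s t) -horner_map /= -map_poly_comp.
by congr (_.[_]); apply: eq_map_poly => D /=; rewrite meval_poly_in_Y.
Qed.

Definition bivar_inv : {mpoly K[2]} -> {poly {poly K}} :=
  mmap (polyC \o polyC) (pt2 'X 'X%:P).
HB.instance Definition _ := GRing.RMorphism.on bivar_inv.

Lemma bivar_invK g : bivar (bivar_inv g) = g.
Proof.
apply: (mpoly2_ext (F := bivar \o bivar_inv) (G := idfun)) => [c||] /=.
- by rewrite /bivar_inv mmapC /= bivarC poly_in_YC.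
- rewrite /bivar_inv mmapX mmap1U /pt2 (tnth_nth 0) /=.
  by rewrite /bivar /= map_polyX /horner_eval hornerX.
by rewrite /bivar_inv mmapX mmap1U /pt2 (tnth_nth 0) /= bivarC poly_in_YX.
Qed.

(** In the local ring at the origin a nonzero polynomial in [Y] alone is a unit
    times a power of [Y]. *)
Lemma poly_in_Y_split D : D != 0 ->
  exists k, exists2 D', poly_in_Y D = Y ^+ k * D' & D'.@[pt2 0 0] != 0.
Proof.
move=> D0; have [k [D1]] := multiplicity_XsubC D 0; rewrite D0 /= => r ->.
exists k, (poly_in_Y D1); last by rewrite meval_poly_in_Y.
by rewrite subr0 (rmorphM poly_in_Y) (rmorphXn poly_in_Y) /= poly_in_YX mulrC.
Qed.

End Bivariate.

(** The local ring is used only through four properties of the morphism [kappa]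
    from the polynomial ring: they say that [A] is the quotient by [F] of the
    localization at the origin. *)
Section LocalNormalForm.
Variables (K : fieldType) (A : comNzRingType).
Variables (kappa : {rmorphism {mpoly K[2]} -> A}).
Variables (n : nat) (E b1 b0 : {mpoly K[2]}) (c1 c2 : K).
Local Notation F := (E * X ^+ 2 + b1 * X * Y ^+ n + b0 * Y ^+ n ^+ 2).
Local Notation at0 g := (meval (pt2 0 0) g).
Hypothesis n_gt0 : (0 < n)%N.
Hypothesis c12 : c1 != c2.
Hypothesis E0 : at0 E != 0.
Hypothesis b1_0 : at0 b1 = - (at0 E * (c1 + c2)).
Hypothesis b0_0 : at0 b0 = at0 E * (c1 * c2).
Hypothesis kappa_frac : forall a, exists s g : {mpoly K[2]},
  at0 s != 0 /\ kappa s * a = kappa g.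
Hypothesis kappa_unit : forall s : {mpoly K[2]}, at0 s != 0 -> exists t, kappa s * t = 1.
Hypothesis kappaF : kappa F = 0.
Hypothesis kappa_ker : forall g : {mpoly K[2]}, kappa g = 0 ->
  exists s h : {mpoly K[2]}, at0 s != 0 /\ s * g = h * F.

Implicit Types g h s t : {mpoly K[2]}.
Let iA : {rmorphism K -> A} := kappa \o @mpolyC 2 K.

Lemma at0_split g : at0 g = 0 -> exists p q : {mpoly K[2]}, g = Y * p + X * q.
Proof.
by move=> g0; have [p [q e]] := mpoly2_split0 g; exists q, p; rewrite e g0; ring.
Qed.

Lemma local_residue a : exists c p q, a = iA c + kappa Y * p + kappa X * q.
Proof.
have [s [g [s0 e]]] := kappa_frac a; have [t et] := kappa_unit s0.
have [p [q e']] : exists p q, g - (at0 g / at0 s)%:MP * s = Y * p + X * q.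
  by apply: at0_split; rewrite !meval2E mulfVK ?subrr.
exists (at0 g / at0 s), (t * kappa p), (t * kappa q).
have : kappa g = iA (at0 g / at0 s) * kappa s + kappa Y * kappa p
    + kappa X * kappa q.
  have eg : g = (at0 g / at0 s)%:MP * s + (Y * p + X * q) by rewrite -e'; ring.
  by rewrite {1}eg !rmorphD !rmorphM addrA.
rewrite -e => e2.
transitivity (t * (kappa s * a)); first by rewrite mulrA [t * _]mulrC et mul1r.
rewrite e2; transitivity (iA (at0 g / at0 s) * (kappa s * t)
   + kappa Y * (t * kappa p) + kappa X * (t * kappa q)); first by ring.
by rewrite et mulr1.
Qed.

Lemma Y_dvd_curve g h : Y * g = h * F -> exists h', h = Y * h'.
Proof.
move=> /(congr1 (comp2 X 0)); rewrite !comp2E expr0n (gtn_eqF n_gt0) mulr0n.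
have [h' eh] := mpoly2_divY h.
rewrite mul0r => e0.
have /eqP : comp2 X 0 h * (comp2 X 0 E * X ^+ 2) = 0 by rewrite [RHS]e0; ring.
rewrite !mulf_eq0 !(negPf (mpolyX_neq0 _ _)) !orbF.
case/orP => /eqP e; last first.
  move/eqP: E0; case; move/(congr1 (meval (pt2 0 0))): e.
  by rewrite meval_comp2 !meval2E.
by exists h'; rewrite eh e add0r.
Qed.

Lemma F_neq0 : F != 0.
Proof.
apply/eqP => F0; have : Y * 0 = 1 * F by rewrite F0 !mulr0.
case/Y_dvd_curve => h /(congr1 (meval (pt2 0 0))); rewrite !meval2E mul0r.
by move/eqP; rewrite oner_eq0.
Qed.

Lemma local_Y_reg : GRing.lreg (kappa Y).
Proof.
move=> x y e; apply/eqP; rewrite -subr_eq0; apply/eqP.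
have {e} : kappa Y * (x - y) = 0 by rewrite mulrBr e subrr.
move: {x y} (x - y) => a e.
have [s [g [s0 eg]]] := kappa_frac a; have [t et] := kappa_unit s0.
have : kappa (Y * g) = 0 by rewrite rmorphM -eg mulrCA e mulr0.
case/kappa_ker => s' [h [s'0 eh]].
have [h' eh'] : exists h', h = Y * h'.
  by apply: (@Y_dvd_curve (s' * g) h); rewrite -eh mulrCA.
have e' : s' * g = h' * F.
  apply: (mulfI (mpolyX_neq0 K 1)).
  by transitivity (s' * (Y * g)); [|rewrite eh eh']; ring.
have [t' et'] := kappa_unit s'0.
have -> : a = t * (kappa g) by rewrite -eg mulrA [t * _]mulrC et mul1r.
have -> : kappa g = t' * kappa (s' * g).
  by rewrite rmorphM mulrA [t' * _]mulrC et' mul1r.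
by rewrite e' rmorphM kappaF !mulr0.
Qed.

(** Modulo [F], which lies in the ideal [(X, Y^n)^2], the syzygies of [Y^n] and
    [X] have coefficients in [(X, Y^n)]; this uses that [X] and [Y] form a regular
    sequence. *)
Lemma local_syzygy a b : a * kappa Y ^+ n + b * kappa X = 0 ->
  (exists p q, a = kappa Y ^+ n * p + kappa X * q) /\
  (exists p q, b = kappa Y ^+ n * p + kappa X * q).
Proof.
have [s [g [s0 eg]]] := kappa_frac a; have [t et] := kappa_unit s0.
have [s' [g' [s'0 eg']]] := kappa_frac b; have [t' et'] := kappa_unit s'0.
move=> e; have : kappa (s' * g * Y ^+ n + s * g' * X) = 0.
  rewrite rmorphD !rmorphM rmorphXn -eg -eg'.
  transitivity (kappa s * kappa s' * (a * kappa Y ^+ n + b * kappa X));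
    first by ring.
  by rewrite e mulr0.
case/kappa_ker => w [h [w0 eh]].
have [k ek1 ek2] : exists2 k, h * E * X + h * b1 * Y ^+ n - w * s * g' = Y ^+ n * k
   & w * s' * g - h * b0 * Y ^+ n = X * k.
  apply: syzygyXYn; apply/eqP; rewrite -subr_eq0; apply/eqP.
  transitivity (w * (s' * g * Y ^+ n + s * g' * X) - h * F); first by ring.
  by rewrite eh subrr.
have [v ev] := kappa_unit w0.
have inv1 : a = v * t * t' * kappa (w * s' * g).
  transitivity ((kappa w * v) * (kappa s * t) * (kappa s' * t') * a).
    by rewrite et et' ev !mul1r.
  by rewrite !rmorphM -eg; ring.
have inv2 : b = v * t * t' * kappa (w * s * g').
  transitivity ((kappa w * v) * (kappa s * t) * (kappa s' * t') * b).
    by rewrite et et' ev !mul1r.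
  by rewrite !rmorphM -eg'; ring.
split.
  exists (v * t * t' * kappa (h * b0)), (v * t * t' * kappa k).
  rewrite inv1 (_ : w * s' * g = Y ^+ n * (h * b0) + X * k).
    by rewrite rmorphD !rmorphM rmorphXn; ring.
  by rewrite -ek2; ring.
exists (v * t * t' * kappa (h * b1 - k)), (v * t * t' * kappa (h * E)).
rewrite inv2 (_ : w * s * g' = Y ^+ n * (h * b1 - k) + X * (h * E)).
  by rewrite rmorphD ![kappa (_ * (_ - _))]rmorphM rmorphM rmorphXn; ring.
by rewrite mulrBr -ek1; ring.
Qed.

Lemma Y_adic_free m (c : 'I_m -> K) s p : at0 s != 0 ->
  s * \sum_(i < m) (c i)%:MP * Y ^+ i = Y ^+ m * p -> forall i, c i = 0.
Proof.
elim: m c p => [|m IH] c p s0; first by move=> _ [].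
rewrite big_ord_recl expr0 mulr1.
have -> : \sum_(i < m) (c (lift ord0 i))%:MP * Y ^+ lift ord0 i
  = Y * \sum_(i < m) (c (lift ord0 i))%:MP * Y ^+ i :> {mpoly K[2]}.
  by rewrite mulr_sumr; apply: eq_bigr => i _; rewrite exprS mulrCA.
move=> e; have c0 : c ord0 = 0.
  have /(congr1 (meval (pt2 0 0))) := e.
  rewrite !meval2E mul0r addr0 exprS !mul0r => /eqP.
  by rewrite mulf_eq0 (negPf s0) => /eqP.
have c'0 : forall i, c (lift ord0 i) = 0.
  apply: (IH (fun i => c (lift ord0 i)) p s0).
  apply: (mulfI (mpolyX_neq0 K 1)); rewrite mulrCA.
  by rewrite [RHS]mulrA -exprS -e c0 mpolyC0 add0r.
move=> i; case: (unliftP ord0 i) => [i' ->|->] //.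
Qed.

Lemma local_Y_free m (c : 'I_m -> K) p q : (m <= n)%N ->
  \sum_(i < m) iA (c i) * kappa Y ^+ i = kappa Y ^+ m * p + kappa X * q ->
  forall i, c i = 0.
Proof.
move=> mn.
have [s [g [s0 eg]]] := kappa_frac p; have [t [h [t0 eh]]] := kappa_frac q.
set S := (\sum_(i < m) (c i)%:MP * Y ^+ i : {mpoly K[2]}).
have -> : \sum_(i < m) iA (c i) * kappa Y ^+ i = kappa S.
  by rewrite rmorph_sum; apply: eq_bigr => i _; rewrite rmorphM rmorphXn.
move=> e; have : kappa (s * t * S - Y ^+ m * t * g - X * s * h) = 0.
  rewrite !rmorphB !rmorphM e -eg -eh rmorphXn; ring.
case/kappa_ker => w [k [w0 ek]].
apply: (@Y_adic_free m c (comp2 0 Y (w * s * t))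
   (comp2 0 Y (w * t * g + k * b0 * Y ^+ (n - m) * Y ^+ n))).
  by rewrite meval_comp2 !meval2E !mulf_neq0.
have eS : comp2 0 Y S = S.
  rewrite /S raddf_sum; apply: eq_bigr => i _ /=; by rewrite !comp2E.
have en : Y ^+ n = Y ^+ (n - m) * Y ^+ m :> {mpoly K[2]}.
  by rewrite -exprD subnK.
rewrite -/S -eS; have /(congr1 (comp2 0 Y)) : w * s * t * S =
   Y ^+ m * (w * t * g + k * b0 * Y ^+ (n - m) * Y ^+ n)
   + X * (w * s * h + k * E * X + k * b1 * Y ^+ n).
  transitivity (w * (s * t * S - Y ^+ m * t * g - X * s * h)
    + (w * Y ^+ m * t * g + w * X * s * h)); first by ring.
  by rewrite ek expr2 {2 3}en; ring.
by rewrite comp2M comp_mpolyD !comp2M !comp2E mul0r addr0.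
Qed.

(** Let [d] be a greatest common divisor of the numerator [g] of [r] and of [F],
    as polynomials in [X] over the rational functions in [Y].  As [r] is regular,
    so is [d], and then the cofactor of [d] in [F] vanishes on the curve: up to
    units, [d] divides a power of [Y].  The Bezout relation expresses [d] by [g]
    modulo [F], up to a power of [Y]. *)
Lemma local_Y_frac r : GRing.lreg r -> exists k b, kappa Y ^+ k = r * b.
Proof.
move=> reg_r; have [s [g [s0 eg]]] := kappa_frac r.
have [v ev] := kappa_unit s0.
have reg_g : GRing.lreg (kappa g).
  rewrite -eg; apply: lregM => //.
  by move=> x y /(congr1 ( *%R v)); rewrite !mulrA [v * _]mulrC ev !mul1r.
have eF := bivar_invK F; have eg' := bivar_invK g.
move: (bivar_inv F) (bivar_inv g) eF eg' => F' g' eF eg'; pose d := gcdp F' g'.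
have /Pdiv.Idomain.dvdpP[[d1 h] /= d1_0 eF'] : d %| F' by apply: dvdp_gcdl.
have /Pdiv.Idomain.dvdpP[[d2 h'] /= d2_0 eg2] : d %| g' by apply: dvdp_gcdr.
have [[al be] /= /Pdiv.Idomain.eqpP[[e1 e2] /= /andP[e1_0 e2_0] eB]] :=
  Pdiv.Idomain.Bezoutp F' g'.
have {}eF' := congr1 (@bivar K) eF'; have {}eg2 := congr1 (@bivar K) eg2.
have {}eB := congr1 (@bivar K) eB.
rewrite -!mul_polyC !(rmorphM (@bivar K)) /= !bivarC eF eg' in eF' eg2 eB.
rewrite rmorphD !rmorphM /= eF eg' in eB.
move: (poly_in_Y_split d1_0) (poly_in_Y_split d2_0) (poly_in_Y_split e2_0).
move: (poly_in_Y d1) (poly_in_Y d2) (poly_in_Y e1) (poly_in_Y e2) eF' eg2 eB.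
move: (bivar h) (bivar h') (bivar d) (bivar al) (bivar be).
move=> {d1_0 d2_0 e1_0 e2_0}{}h {}h' {}d {}al {}be {}d1 {}d2 {}e1 {}e2 eF' eg2 eB.
move=> [k1 [d1' ed1 d1'0]] [k2 [d2' ed2 d2'0]] [k3 [e2' ee2 e2'0]].
have [t2 et2] := kappa_unit d2'0.
have reg_d : GRing.lreg (kappa d).
  move=> x y exy.
  have Yg_reg := lregM (@lregX _ _ k2 local_Y_reg) reg_g; apply: Yg_reg.
  have eqz z : kappa Y ^+ k2 * kappa g * z = t2 * kappa h' * (kappa d * z).
    transitivity (kappa d2' * t2 * (kappa Y ^+ k2 * kappa g * z)).
      by rewrite et2 mul1r.
    transitivity (t2 * (kappa (Y ^+ k2 * d2' * g)) * z).
      by rewrite !rmorphM rmorphXn; ring.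
    by rewrite -ed2 eg2 rmorphM; ring.
  by rewrite !eqz exy.
have [w [tau [w0 ew]]] : exists w tau, at0 w != 0 /\ w * h = tau * F.
  apply: kappa_ker; apply: reg_d; rewrite mulr0 mulrC -rmorphM -eF'.
  by rewrite rmorphM kappaF mulr0.
have e_d1 : d1 * w = tau * d.
  apply: (mulfI F_neq0); transitivity (w * (d1 * F)); first by ring.
  by rewrite eF' mulrA ew; ring.
have kg : kappa e1 * kappa be * kappa g = kappa e2 * kappa d.
  move/(congr1 kappa): eB; rewrite !rmorphM rmorphD !rmorphM kappaF => <-.
  by ring.
have [v1 ev1] := kappa_unit d1'0; have [v2 ev2] := kappa_unit w0.
have [v3 ev3] := kappa_unit e2'0.
exists (k1 + k3)%N.
exists (kappa s * (v1 * v2 * v3 * kappa tau * kappa e1 * kappa be)).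
have -> : r * (kappa s * (v1 * v2 * v3 * kappa tau * kappa e1 * kappa be))
  = v1 * v2 * v3 * kappa tau * (kappa e1 * kappa be * (kappa s * r)) by ring.
rewrite eg kg ee2 exprD.
have -> : v1 * v2 * v3 * kappa tau * (kappa (Y ^+ k3 * e2') * kappa d)
  = v1 * v2 * v3 * kappa (Y ^+ k3 * e2') * kappa (tau * d).
  by rewrite [kappa (tau * d)]rmorphM; ring.
rewrite -e_d1 ed1 !rmorphM !rmorphXn.
transitivity ((kappa d1' * v1) * (kappa w * v2) * (kappa e2' * v3)
   * kappa Y ^+ k1 * kappa Y ^+ k3); first by rewrite ev1 ev2 ev3 !mul1r.
by ring.

Qed.

Theorem quot_dim_local_normal_form (T : comNzRingType) (j : {rmorphism A -> T})
    (iT : {rmorphism K -> T}) : injective j ->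
  (forall s : A, GRing.lreg s -> exists t : T, j s * t = 1) ->
  (forall z, exists s a : A, GRing.lreg s /\ j s * z = j a) ->
  (forall c, iT c = j (kappa c%:MP)) ->
  quot_dim iT (integralOver j) (fun z => exists a, z = j a) n.
Proof.
move=> j_inj j_unit j_frac iTE; have [E' EE'] := kappa_unit E0.
apply: (@quot_dim_normalization _ _ _ iA j j_inj j_unit j_frac n (kappa X) (kappa Y)
  (kappa E) E' (kappa b1) (kappa b0) c1 c2) => //.
- by rewrite -!rmorphXn -!rmorphM -!rmorphD.
- have [p [q e]] : exists p q, b1 + E * (c1 + c2)%:MP = Y * p + X * q.
    by apply: at0_split; rewrite mevalD mevalM mevalC b1_0; ring.
  exists (kappa p), (kappa q); rewrite /iA /= -!rmorphM -rmorphN -addrA -!rmorphD.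
  by congr (kappa _); rewrite -e; ring.
- have [p [q e]] : exists p q, b0 - E * (c1 * c2)%:MP = Y * p + X * q.
    by apply: at0_split; rewrite mevalB mevalM mevalC b0_0; ring.
  exists (kappa p), (kappa q); rewrite /iA /= -!rmorphM -addrA -!rmorphD.
  by congr (kappa _); rewrite -e; ring.
- exact: local_residue.
- exact: local_Y_reg.
- exact: local_syzygy.
- exact: local_Y_free.
exact: local_Y_frac.
Qed.

End LocalNormalForm.

Section LocalCurve.
Variables (K : fieldType) (x : 'I_2 -> K) (f : {mpoly K[2]}) (fx : f.@[x] = 0).

Implicit Types g s h : {mpoly K[2]}.
Let kappa : {rmorphism {mpoly K[2]} -> local_curve_ring fx} :=
  to_principal_quot (to_local_ring_nonunit fx) \o @to_local_ring K 2 x.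

Lemma local_ring_frac (z : local_ring x) :
  exists s g : {mpoly K[2]}, s.@[x] != 0 /\ to_local_ring x s * z = to_local_ring x g.
Proof.
have [g [s ->]] := @loc_mk_ex _ _ (nonvanishing0 x) z.
exists (sval s), g; split; first exact: (valP s).
rewrite -[LHS]/(loc_mul _ _) /to_local_ring /loc_inj loc_mulE.
by apply/loc_mkP; exists 1; rewrite ?rpred1 //=; ring.
Qed.

Lemma local_ring_unit s : s.@[x] != 0 -> exists t, to_local_ring x s * t = 1.
Proof.
move=> s0; exists (loc_mk (nonvanishing0 x) 1 (exist _ s s0)).
rewrite -[LHS]/(loc_mul _ _) /to_local_ring /loc_inj loc_mulE.
by apply/loc_mkP; exists 1; rewrite ?rpred1 //=; ring.
Qed.

Lemma local_curve_frac a :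
  exists s g : {mpoly K[2]}, s.@[x] != 0 /\ kappa s * a = kappa g.
Proof.
have [s [g [s0 e]]] := local_ring_frac (repr a); exists s, g; split=> //.
by rewrite /kappa /= -e rmorphM /= /to_principal_quot reprK.
Qed.

Lemma local_curve_unit s : s.@[x] != 0 -> exists t, kappa s * t = 1.
Proof.
move=> /local_ring_unit[t e].
exists (to_principal_quot (to_local_ring_nonunit fx) t).
by rewrite /kappa /= -rmorphM e rmorph1.
Qed.

Lemma local_curve_self : kappa f = 0.
Proof.
rewrite /kappa /= -(rmorph0 (to_principal_quot (to_local_ring_nonunit fx))).
apply/eqP; rewrite -Quotient.idealrBE subr0; apply/asboolP.
by exists 1; rewrite mul1r.
Qed.

Lemma local_curve_ker g : kappa g = 0 ->
  exists s h : {mpoly K[2]}, s.@[x] != 0 /\ s * g = h * f.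
Proof.
rewrite /kappa /= -(rmorph0 (to_principal_quot (to_local_ring_nonunit fx))).
move/eqP; rewrite -Quotient.idealrBE subr0 => /asboolP[z ez].
have [s [h [s0 e]]] := local_ring_frac z.
have : to_local_ring x (s * g) = to_local_ring x (h * f).
  by rewrite !rmorphM /= -e ez mulrA.
case/loc_mkP => t tS /=; rewrite !mulr1 !mulrA => e'.
by exists (t * s), (t * h); split => //; rewrite mevalM mulf_neq0.
Qed.

End LocalCurve.

Section TotalFractionsFacts.
Variable A : comNzRingType.

Lemma to_total_fractions_inj : injective (@to_total_fractions A).
Proof.
by move=> a b /loc_mkP[u /asboolP u_reg /=]; rewrite !mulr1 => /u_reg.
Qed.

Lemma total_fractions_unit (s : A) : GRing.lreg s ->
  exists t, to_total_fractions s * t = 1.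
Proof.
move=> s_reg; have s_in : s \in @regular_elt A by apply/asboolP.
exists (loc_mk (regular_elt0 A) 1 (exist _ s s_in)).
rewrite -[LHS]/(loc_mul _ _) /to_total_fractions /loc_inj loc_mulE.
by apply/loc_mkP; exists 1; rewrite ?rpred1 //=; ring.
Qed.

Lemma total_fractions_frac (z : total_fractions A) :
  exists s a, GRing.lreg s /\ to_total_fractions s * z = to_total_fractions a.
Proof.
have [a [s ->]] := @loc_mk_ex _ _ (regular_elt0 A) z; exists (sval s), a; split.
  exact/asboolP/(valP s).
rewrite -[LHS]/(loc_mul _ _) /to_total_fractions /loc_inj loc_mulE.
by apply/loc_mkP; exists 1; rewrite ?rpred1 //=; ring.
Qed.
End TotalFractionsFacts.

(** [(p, q)] is a system of coordinates at the point, with inverse [(p', q')], in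
    which the curve takes its normal form. *)
Theorem delta_normal_form (K : fieldType) (n : nat) (a b c1 c2 : K)
    (f p q p' q' E b1 b0 : {mpoly K[2]}) :
  (0 < n)%N -> c1 != c2 ->
  p.@[pt2 0 0] = a -> q.@[pt2 0 0] = b ->
  p'.@[pt2 a b] = 0 -> q'.@[pt2 a b] = 0 ->
  comp2 p q p' = X -> comp2 p q q' = Y ->
  comp2 p' q' p = X -> comp2 p' q' q = Y ->
  comp2 p q f = E * X ^+ 2 + b1 * X * Y ^+ n + b0 * Y ^+ n ^+ 2 ->
  E.@[pt2 0 0] != 0 ->
  b1.@[pt2 0 0] = - (E.@[pt2 0 0] * (c1 + c2)) ->
  b0.@[pt2 0 0] = E.@[pt2 0 0] * (c1 * c2) ->
  delta_invariant f (pt2 a b) n.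
Proof.
move=> n_gt0 c12 p0 q0 p'0 q'0 pp' qq' p'p q'q fE E0 b1_0 b0_0.
have invK g : comp2 p' q' (comp2 p q g) = g by rewrite comp2A p'p q'q comp2_id.
have invK' g : comp2 p q (comp2 p' q' g) = g by rewrite comp2A pp' qq' comp2_id.
have ev0 g : (comp2 p q g).@[pt2 0 0] = g.@[pt2 a b] by rewrite meval_comp2 p0 q0.
have ev1 g : (comp2 p' q' g).@[pt2 a b] = g.@[pt2 0 0].
  by rewrite meval_comp2 p'0 q'0.
have fx : f.@[pt2 a b] = 0.
  rewrite -ev0 fE !meval2E expr0n; have /gtn_eqF -> := n_gt0.
  by rewrite mulr0n; ring.
exists fx.
pose kappa : {rmorphism _ -> local_curve_ring fx} :=
  (to_principal_quot (to_local_ring_nonunit fx) \o @to_local_ring K 2 (pt2 a b))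
  \o comp2 p' q'.
apply: (@quot_dim_local_normal_form K (local_curve_ring fx) kappa n E b1 b0 c1 c2).
- exact: n_gt0.
- exact: c12.
- exact: E0.
- exact: b1_0.
- exact: b0_0.
- move=> z; have [s [g [s0 e]]] := @local_curve_frac _ _ _ fx z.
  by exists (comp2 p q s), (comp2 p q g); rewrite ev0 /kappa /= !invK.
- by move=> s s0; apply: local_curve_unit; rewrite ev1.
- by rewrite -fE /kappa /= invK; apply: local_curve_self.
- move=> g /local_curve_ker[s [h [s0 e]]].
  exists (comp2 p q s), (comp2 p q h); rewrite ev0; split=> //.
  by rewrite -fE -comp2M -e comp2M invK'.
- exact: to_total_fractions_inj.
- exact: total_fractions_unit.
- exact: total_fractions_frac.
by move=> c; rewrite /kappa /= comp_mpolyC.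
Qed.

(** * Order of contact and delta *)

(** If [m > n], a linear relation between the coordinates in the first basis of the
    elements of the second one contradicts the uniqueness of coordinates in the
    second basis. *)
Lemma quot_dim_leq (K : fieldType) (B : comNzRingType)
    (iota : {rmorphism K -> B}) (V W : B -> Prop) (m n : nat) :
  W 0 -> (forall x y, W x -> W y -> W (x + y)) ->
  (forall c x, W x -> W (iota c * x)) ->
  quot_dim iota V W n -> quot_dim iota V W m -> (m <= n)%N.
Proof.
move=> W0 WD WZ [b [Vb bP]] [b' [Vb' b'P]].
have /choice[c cP] : forall i, exists c : {ffun 'I_n -> K},
    W (b' i - \sum_(k < n) iota (c k) * b k).
  by move=> i; have [c [Wc _]] := bP _ (Vb' i); exists c.
pose M := \matrix_(i, k) c i k.
rewrite leqNgt; apply/negP => nm.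
have : kermx M != 0.
  rewrite -mxrank_eq0 mxrank_ker subn_eq0 -ltnNge.
  by rewrite (leq_ltn_trans (rank_leq_col M)).
case/rowV0Pn => v /sub_kermxP vM v0.
have Wv : W (\sum_i iota (v 0 i) * b' i).
  have -> : \sum_i iota (v 0 i) * b' i =
      \sum_i iota (v 0 i) * (b' i - \sum_(k < n) iota (c i k) * b k).
    apply/eqP; rewrite -subr_eq0 -sumrB; apply/eqP.
    under eq_bigr => i _ do rewrite -mulrBr opprB addrC subrK mulr_sumr.
    rewrite exchange_big /=; apply: big1 => k _.
    under eq_bigr => i _ do rewrite mulrA -rmorphM.
    rewrite -mulr_suml -rmorph_sum.
    have -> : \sum_i v 0 i * c i k = (v *m M) 0 k.
      by rewrite mxE; apply: eq_bigr => j _; rewrite mxE.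
    by rewrite vM mxE rmorph0 mul0r.
  by apply: big_ind => // i _; apply: WZ.
have [i vi0] : exists i, v 0 i != 0.
  apply/existsP; apply: contraNT v0; rewrite negb_exists => /forallP h.
  by apply/eqP/rowP => i; rewrite mxE; apply/eqP; move: (h i); rewrite negbK.
have [d [Wd d_uniq]] := b'P _ (Vb' i).
have : d = [ffun k => d k - v 0 k].
  apply: d_uniq.
  have -> : b' i - \sum_(k < m) iota ([ffun k0 => d k0 - v 0 k0] k) * b' k
    = (b' i - \sum_(k < m) iota (d k) * b' k) + \sum_k iota (v 0 k) * b' k.
    rewrite -addrA; congr (_ + _); apply/eqP; rewrite eqr_oppLR opprD opprK.
    rewrite -sumrB; apply/eqP; apply: eq_bigr => k _.
    by rewrite ffunE rmorphB mulrBl.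
  exact: WD.
move/ffunP/(_ i)/eqP; rewrite ffunE -subr_eq0 opprB addrC subrK.
by rewrite (negPf vi0).
Qed.

Lemma delta_unique (K : fieldType) (f : {mpoly K[2]}) x m n :
  delta_invariant f x m -> delta_invariant f x n -> m = n.
Proof.
move=> [fx dm] [fx' dn]; have efx : fx' = fx by apply: Prop_irrelevance.
rewrite {}efx in dn.
have W0 : exists a, 0 = to_local_curve_fractions fx a by exists 0; rewrite rmorph0.
have WD u v : (exists a, u = to_local_curve_fractions fx a) ->
  (exists a, v = to_local_curve_fractions fx a) ->
  exists a, u + v = to_local_curve_fractions fx a.
  by move=> [a ->] [b ->]; exists (a + b); rewrite rmorphD.
have WZ (c : K) u : (exists a, u = to_local_curve_fractions fx a) ->
  exists a, scalar_to_fractions fx c * u = to_local_curve_fractions fx a.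
  by move=> [a ->]; eexists; rewrite /scalar_to_fractions /= -rmorphM.
apply/eqP; rewrite eqn_leq.
by rewrite (quot_dim_leq W0 WD WZ dn dm) (quot_dim_leq W0 WD WZ dm dn).
Qed.

Section ShearedCoordinates.
Variable K : fieldType.
Variables (n : nat) (a b c1 c2 : K) (f phi E b1 b0 : {mpoly K[2]}).
Hypotheses (n_gt0 : (0 < n)%N) (c12 : c1 != c2).
Hypotheses (phiY : comp2 0 Y phi = phi) (phi0 : phi.@[pt2 0 0] = 0).
Hypothesis E0 : E.@[pt2 0 0] != 0.
Hypothesis b1_0 : b1.@[pt2 0 0] = - (E.@[pt2 0 0] * (c1 + c2)).
Hypothesis b0_0 : b0.@[pt2 0 0] = E.@[pt2 0 0] * (c1 * c2).
Local Notation normal_form := (E * X ^+ 2 + b1 * X * Y ^+ n + b0 * Y ^+ n ^+ 2).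

Let phiYr (r q : {mpoly K[2]}) : comp2 r q phi = comp2 0 q phi.
Proof. by rewrite -phiY !comp2A !comp2E. Qed.

Lemma delta_shear :
  comp2 (a%:MP + phi + X) (b%:MP + Y) f = normal_form ->
  delta_invariant f (pt2 a b) n.
Proof.
move=> fE.
have XK (x y : {mpoly K[2]}) : x + y - x = y by rewrite addrC addKr.
apply: (@delta_normal_form K n a b c1 c2 f (a%:MP + phi + X) (b%:MP + Y)
  (X - a%:MP - comp2 0 (Y - b%:MP) phi) (Y - b%:MP) E b1 b0 n_gt0 c12 _ _ _ _ _ _ _ _
  fE E0 b1_0 b0_0).
- by rewrite !meval2E phi0 !addr0.
- by rewrite !meval2E addr0.
- by rewrite !meval2E meval_comp2 !meval2E !subrr phi0 subrr.
- by rewrite !meval2E subrr.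
- by rewrite !comp2E comp2A !comp2E (XK b%:MP) phiY -(addrA a%:MP) (XK a%:MP) (XK phi).
- by rewrite !comp2E (XK b%:MP).
- by rewrite !comp2E phiYr; move: (comp2 0 _ _) => z; ring.
by rewrite !comp2E; ring.
Qed.

Lemma delta_shear_swap :
  comp2 (a%:MP + Y) (b%:MP + phi + X) f = normal_form ->
  delta_invariant f (pt2 a b) n.
Proof.
move=> fE.
have XK (x y : {mpoly K[2]}) : x + y - x = y by rewrite addrC addKr.
apply: (@delta_normal_form K n a b c1 c2 f (a%:MP + Y) (b%:MP + phi + X)
  (Y - b%:MP - comp2 0 (X - a%:MP) phi) (X - a%:MP) E b1 b0 n_gt0 c12 _ _ _ _ _ _ _ _
  fE E0 b1_0 b0_0).
- by rewrite !meval2E addr0.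
- by rewrite !meval2E phi0 !addr0.
- by rewrite !meval2E meval_comp2 !meval2E !subrr phi0 subrr.
- by rewrite !meval2E subrr.
- by rewrite !comp2E comp2A !comp2E (XK a%:MP) phiY -(addrA b%:MP) (XK b%:MP) (XK phi).
- by rewrite !comp2E (XK a%:MP).
- by rewrite !comp2E; ring.
by rewrite !comp2E phiYr; move: (comp2 0 _ _) => z; ring.
Qed.
End ShearedCoordinates.

Section Contact.
Variable R : realType.
Implicit Types (f g phi : {mpoly R[2]}) (a b : R).

(** Both branches of [f] at [(a, b)] have the form
    [x = a + phi(y - b) + (y - b)^n u], where [u] tends to one of two conjugate
    complex numbers, the roots of [e z^2 + beta z + gam].  The first condition
    says that the variable [X] does not occur in [phi]. *)
Definition contact f a b n := exists (phi g : {mpoly R[2]}) (e beta gam : R),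
  [/\ comp2 0 Y phi = phi /\ phi.@[pt2 0 0] = 0,
      comp2 (a%:MP + phi + Y ^+ n * X) (b%:MP + Y) f = Y ^+ n ^+ 2 * g,
      0 < e, beta ^+ 2 < 4 * e * gam &
      forall u, g.@[pt2 u 0] = e * u ^+ 2 + beta * u + gam].

Lemma quadratic_coefs (e be ga e' be' ga' : R) :
  (forall u, e * u ^+ 2 + be * u + ga = e' * u ^+ 2 + be' * u + ga') ->
  [/\ e = e', be = be' & ga = ga'].
Proof.
move=> h; have := h 0; have := h 1; have := h (-1).
by move=> h1 h2 h3; split; lra.
Qed.

(** Substituting [X = 0] in successive quotients by [X] identifies the first two
    coefficients of the sheared polynomial as multiples of [Y^(2n)] and [Y^n], and
    the remainder with [E]. *)
Lemma contact_normal_form f a b n : (0 < n)%N -> contact f a b n ->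
  exists phi E b1 b0 : {mpoly R[2]},
  [/\ comp2 0 Y phi = phi /\ phi.@[pt2 0 0] = 0,
      comp2 (a%:MP + phi + X) (b%:MP + Y) f =
         E * X ^+ 2 + b1 * X * Y ^+ n + b0 * Y ^+ n ^+ 2,
      0 < E.@[pt2 0 0] &
      b1.@[pt2 0 0] ^+ 2 < 4 * E.@[pt2 0 0] * b0.@[pt2 0 0] ].
Proof.
move=> n_gt0 [phi [g [e [be [ga [[phiY phi0] eg e0 disc gE]]]]]].
pose F := comp2 (a%:MP + phi + X) (b%:MP + Y) f.
have phiYr r : comp2 r Y phi = phi by rewrite -phiY comp2A !comp2E.
have eF : comp2 (Y ^+ n * X) Y F = Y ^+ n ^+ 2 * g.
  rewrite /F comp2A !comp2E phiYr -eg; congr (comp_mpoly [tuple _; _] f); ring.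
have Yn0 : Y ^+ n != 0 :> {mpoly R[2]} by rewrite expf_neq0 ?mpolyX_neq0.
have [F' eF'] := mpoly2_divX F; have [F2 eF2] := mpoly2_divX F'.
have [g' eg'] := mpoly2_divX g; have [g2 eg2] := mpoly2_divX g'.
have e00 : comp2 0 Y F = Y ^+ n ^+ 2 * comp2 0 Y g.
  move/(congr1 (comp2 0 Y)): eF; rewrite comp2A !comp2E mulr0.
  by move=> ->; ring.
have e1 : comp2 (Y ^+ n * X) Y F' = Y ^+ n * g'.
  have := eF; rewrite eF' comp_mpolyD comp2A !comp2E e00 {2}eg' => h.
  have hh : Y ^+ n * X * comp2 (Y ^+ n * X) Y F' = Y ^+ n * X * (Y ^+ n * g').
    by apply: (addrI (Y ^+ n ^+ 2 * comp2 0 Y g)); rewrite h; ring.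
  by apply: (mulfI _ hh); rewrite mulf_neq0 ?mpolyX_neq0.
have e10 : comp2 0 Y F' = Y ^+ n * comp2 0 Y g'.
  by move/(congr1 (comp2 0 Y)): e1; rewrite comp2A !comp2E mulr0.
have e2 : comp2 (Y ^+ n * X) Y F2 = g2.
  have := e1; rewrite eF2 comp_mpolyD comp2A !comp2E e10 {2}eg2 => h.
  have hh : Y ^+ n * X * comp2 (Y ^+ n * X) Y F2 = Y ^+ n * X * g2.
    by apply: (addrI (Y ^+ n * comp2 0 Y g')); rewrite h; ring.
  by apply: (mulfI _ hh); rewrite mulf_neq0 ?mpolyX_neq0.
pose E := F2; pose b1 := comp2 0 Y g'; pose b0 := comp2 0 Y g.
have gE' u : g.@[pt2 u 0] = E.@[pt2 0 0] * u ^+ 2 + b1.@[pt2 0 0] * u + b0.@[pt2 0 0].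
  rewrite eg' eg2 -e2 !meval2E !meval_comp2 !meval2E expr0n.
  by have /gtn_eqF -> := n_gt0; rewrite mulr0n mul0r; ring.
have [eE eb1 eb0] := quadratic_coefs (fun u => etrans (esym (gE' u)) (gE u)).
exists phi, E, b1, b0; split=> //; rewrite ?eE ?eb1 ?eb0 //.
by rewrite -/F eF' eF2 e00 e10 /E /b1 /b0; ring.
Qed.

End Contact.

(** The field of complex numbers enters as an arbitrary extension of the reals in
    which [-1] is a square. *)
Section ContactDelta.
Variables (R : realType) (K : fieldType) (iota : {rmorphism R -> K}) (i : K).
Hypothesis i2 : i ^+ 2 = -1.
Implicit Types (f g phi : {mpoly R[2]}) (a b : R).
Local Notation "x %:C" := (iota x).
Local Notation mapK := (map_mpoly iota).

Lemma map2U (k : 'I_2) : mapK ('X_k : {mpoly R[2]}) = 'X_k.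
Proof. exact: map_mpolyX. Qed.

Lemma map2C (c : R) : mapK (c%:MP : {mpoly R[2]}) = (c%:C)%:MP.
Proof. exact: map_mpolyC. Qed.

Lemma map2D (f g : {mpoly R[2]}) :
  mapK (f + g) = mapK f + mapK g.
Proof. exact: rmorphD. Qed.

Lemma map2_comp2 (p q f : {mpoly R[2]}) :
  mapK (comp2 p q f) = comp2 (mapK p) (mapK q) (mapK f).
Proof.
pose c : {rmorphism {mpoly R[2]} -> {mpoly K[2]}} := map_mpoly iota.
apply: (mpoly2_ext (F := c \o comp2 p q)
   (G := comp2 (mapK p) (mapK q) \o c)) => [k||] /=.
- by rewrite /c /= comp_mpolyC map_mpolyC comp_mpolyC.
- by rewrite /c /= map_mpolyX !comp2E.
by rewrite /c /= map_mpolyX !comp2E.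
Qed.

Lemma map2_at (f : {mpoly R[2]}) a b :
  (mapK f).@[pt2 a%:C b%:C] = (f.@[pt2 a b])%:C.
Proof.
pose c : {rmorphism {mpoly R[2]} -> {mpoly K[2]}} := map_mpoly iota.
apply: (mpoly2_ext (F := meval (pt2 a%:C b%:C) \o c)
   (G := iota \o meval (pt2 a b))) => [k||] /=.
- by rewrite /c /= map_mpolyC !mevalC.
- by rewrite /c /= map_mpolyX !meval2E.
by rewrite /c /= map_mpolyX !meval2E.
Qed.

Lemma quadratic_roots (e be ga : R) : 0 < e -> be ^+ 2 < 4 * e * ga ->
  exists c1 c2 : K, [/\ c1 != c2, iota be = - (iota e * (c1 + c2)) &
    iota ga = iota e * (c1 * c2)].
Proof.
move=> e0 disc; pose w := Num.sqrt (4 * e * ga - be ^+ 2).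
have w2 : w ^+ 2 = 4 * e * ga - be ^+ 2 by rewrite sqr_sqrtr // subr_ge0 ltW.
have w0 : w != 0 by rewrite sqrtr_eq0 -ltNge subr_gt0.
have e2 : e != 0 by rewrite gt_eqF.
have i0 : i != 0.
  by apply: contraPneq (i2) => ->; rewrite expr0n => /esym/eqP; rewrite oppr_eq0 oner_eq0.
exists (iota (- be / (2 * e)) + i * iota (w / (2 * e))),
  (iota (- be / (2 * e)) - i * iota (w / (2 * e))); split.
- rewrite -subr_eq0 (_ : _ - _ = i * iota (w / e)).
    by rewrite mulf_neq0 // fmorph_eq0 mulf_neq0 ?invr_eq0.
  have -> : w / e = w / (2 * e) + w / (2 * e) by field.
  by rewrite rmorphD; ring.
- have be_e : be = - (e * ((- be / (2 * e)) + (- be / (2 * e)))) by field.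
  by rewrite {1}be_e rmorphN rmorphM rmorphD; congr (- (_ * _)); ring.
have -> : ga = e * ((- be / (2 * e)) ^+ 2 + (w / (2 * e)) ^+ 2).
  have -> : ga = (w ^+ 2 + be ^+ 2) / (4 * e) by rewrite w2; field.
  by field.
rewrite rmorphM rmorphD !rmorphXn; congr (_ * _).
move: (iota (- be / _)) (iota (w / _)) => x y.
transitivity (x ^+ 2 - i ^+ 2 * y ^+ 2).
  by rewrite i2; ring.
by ring.
Qed.

Lemma map2_normal_form n (E b1 b0 : {mpoly R[2]}) :
  mapK (E * X ^+ 2 + b1 * X * Y ^+ n + b0 * Y ^+ n ^+ 2) =
  mapK E * X ^+ 2 + mapK b1 * X * Y ^+ n +
  mapK b0 * Y ^+ n ^+ 2.
Proof.
by rewrite !rmorphD !rmorphM !rmorphXn /= !map2U.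
Qed.

Lemma map2_at0 (g : {mpoly R[2]}) :
  (mapK g).@[pt2 0 0] = (g.@[pt2 0 0])%:C.
Proof. by have := map2_at g 0 0; rewrite rmorph0. Qed.

Lemma map2_shear_const phi : comp2 0 Y phi = phi ->
  comp2 0 Y (mapK phi) = mapK phi.
Proof.
move/(congr1 mapK); rewrite map2_comp2 map2U.
by rewrite [mapK 0]rmorph0.
Qed.

Lemma contact_delta f a b n : (0 < n)%N -> contact f a b n ->
  delta_invariant (mapK f) (pt2 a%:C b%:C) n.
Proof.
move=> n_gt0 /(contact_normal_form n_gt0)[phi [E [b1 [b0 [[phiY phi0] eF E0 disc]]]]].
have [c1 [c2 [c12 eb1 eb0]]] := quadratic_roots E0 disc.
have := congr1 mapK eF; rewrite map2_comp2 map2_normal_form.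
have -> : mapK (a%:MP + phi + X) = a%:C%:MP + mapK phi + X.
  by rewrite !map2D map2U map2C.
have -> : mapK (b%:MP + Y) = b%:C%:MP + Y.
  by rewrite !map2D map2U map2C.
apply: (delta_shear n_gt0 c12 (map2_shear_const phiY)).
- by rewrite map2_at0 phi0 rmorph0.
- by rewrite map2_at0 fmorph_eq0 gt_eqF.
- by rewrite !map2_at0.
by rewrite !map2_at0.
Qed.

Lemma contact_swap_delta f a b n : (0 < n)%N -> contact (comp2 Y X f) b a n ->
  delta_invariant (mapK f) (pt2 a%:C b%:C) n.
Proof.
move=> n_gt0 /(contact_normal_form n_gt0)[phi [E [b1 [b0 [[phiY phi0] eF E0 disc]]]]].
have [c1 [c2 [c12 eb1 eb0]]] := quadratic_roots E0 disc.
rewrite comp2A !comp2E in eF.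
have := congr1 mapK eF; rewrite map2_comp2 map2_normal_form.
have -> : mapK (b%:MP + phi + X) = b%:C%:MP + mapK phi + X.
  by rewrite !map2D map2U map2C.
have -> : mapK (a%:MP + Y) = a%:C%:MP + Y.
  by rewrite !map2D map2U map2C.
apply: (delta_shear_swap n_gt0 c12 (map2_shear_const phiY)).
- by rewrite map2_at0 phi0 rmorph0.
- by rewrite map2_at0 fmorph_eq0 gt_eqF.
- by rewrite !map2_at0.
by rewrite !map2_at0.
Qed.

End ContactDelta.

(** * Second order behaviour at an isolated minimum *)

Section IsolatedMinimum.
Variable R : realType.
Implicit Types (f g h : {mpoly R[2]}) (a b s t : R).

Lemma meval_bounded f a b : exists2 M, 0 < M &
  forall s t, `|s - a| <= 1 -> `|t - b| <= 1 -> `|f.@[pt2 s t]| <= M.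
Proof.
move: f; apply: mpoly2_ind => [c|||g h [M M0 gM] [N N0 hN]|g h [M M0 gM] [N N0 hN]].
- by exists (`|c| + 1) => [|s t _ _]; rewrite ?meval2E ?lerDl // ltr_wpDl.
- exists (`|a| + 1) => [|s t sa _]; first by rewrite ltr_wpDl.
  by rewrite meval2X -(subrK a s) addrC (le_trans (ler_normD _ _)) // lerD2l.
- exists (`|b| + 1) => [|s t _ tb]; first by rewrite ltr_wpDl.
  by rewrite meval2Y -(subrK b t) addrC (le_trans (ler_normD _ _)) // lerD2l.
- exists (M + N) => [|s t sa tb]; first exact: addr_gt0.
  by rewrite mevalD (le_trans (ler_normD _ _)) // lerD ?gM ?hN.
exists (M * N) => [|s t sa tb]; first exact: mulr_gt0.
by rewrite mevalM normrM ler_pM ?gM ?hN.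
Qed.

Lemma meval_near_gt0 f a b : 0 < f.@[pt2 a b] -> exists2 d, 0 < d &
  forall s t, `|s - a| < d -> `|t - b| < d -> 0 < f.@[pt2 s t].
Proof.
move=> f0; have [g [h e]] := mpoly2_split0 (comp2 (a%:MP + X) (b%:MP + Y) f).
have [M M0 gM] := meval_bounded g 0 0; have [N N0 hN] := meval_bounded h 0 0.
have MN0 : 0 < M + N by apply: addr_gt0.
pose d := Num.min 1 (f.@[pt2 a b] / (M + N)).
have d0 : 0 < d by rewrite lt_min ltr01 divr_gt0.
exists d => // s t sa tb.
have -> : f.@[pt2 s t] = f.@[pt2 a b] + (s - a) * g.@[pt2 (s - a) (t - b)]
     + (t - b) * h.@[pt2 (s - a) (t - b)].
  have := congr1 (meval (pt2 (s - a) (t - b))) e.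
  by rewrite !meval2E !meval_comp2 !meval2E ![_ + (_ - _)]addrC !subrK !addr0.
have small (u : R) : `|u| < d -> `|u - 0| <= 1.
  by rewrite subr0 => /ltW/le_trans; apply; rewrite ge_min lexx.
have gb : `|(s - a) * g.@[pt2 (s - a) (t - b)]| <= `|s - a| * M.
  by rewrite normrM ler_wpM2l ?gM ?small.
have hb : `|(t - b) * h.@[pt2 (s - a) (t - b)]| <= `|t - b| * N.
  by rewrite normrM ler_wpM2l ?hN ?small.
have : `|s - a| * M + `|t - b| * N < f.@[pt2 a b].
  apply: (@lt_le_trans _ _ (d * M + d * N)).
    by rewrite ltrD // ltr_pM2r.
  by rewrite -mulrDr -ler_pdivlMr // ge_min lexx orbT.
move: gb hb; rewrite !ler_norml => /andP[gb _] /andP[hb _] *; lra.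
Qed.

Lemma meval_ge0_closed f d : 0 < d ->
  (forall e, 0 < e -> e < d -> 0 <= f.@[pt2 e 0]) -> 0 <= f.@[pt2 0 0].
Proof.
move=> d0 f_ge0; rewrite leNgt; apply/negP => f0.
have [|d' d'0 nf_gt0] := @meval_near_gt0 (- f) 0 0; first by rewrite mevalN oppr_gt0.
pose e := Num.min d d' / 2.
have m0 : 0 < Num.min d d' by rewrite lt_min d0.
have e0 : 0 < e by rewrite divr_gt0.
have em : e < Num.min d d' by rewrite /e ltr_pdivrMr // ltr_pMr // ltr1n.
have ed : e < d by rewrite (lt_le_trans em) // ge_min lexx.
have := nf_gt0 e 0; rewrite !subr0 normr0 gtr0_norm // mevalN oppr_gt0.
have ed' : e < d' by rewrite (lt_le_trans em) // ge_min lexx orbT.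
by move=> /(_ ed' d'0); rewrite ltNge f_ge0.
Qed.

Definition isolated_min f a b := f.@[pt2 a b] = 0 /\
  exists2 d, 0 < d & forall s t, `|s - a| < d -> `|t - b| < d ->
    s != a \/ t != b -> 0 < f.@[pt2 s t].

Definition quad (k20 k11 k02 : R) s t := k20 * s ^+ 2 + k11 * s * t + k02 * t ^+ 2.

Definition taylor2 f a b (k20 k11 k02 : R) := exists A B C D : {mpoly R[2]},
  comp2 (a%:MP + X) (b%:MP + Y) f =
    k20%:MP * X ^+ 2 + k11%:MP * X * Y + k02%:MP * Y ^+ 2
    + X ^+ 3 * A + X ^+ 2 * Y * B + X * Y ^+ 2 * C + Y ^+ 3 * D.

Lemma isolated_min_ge0 f a b : isolated_min f a b ->
  exists2 d, 0 < d & forall s t, `|s - a| < d -> `|t - b| < d -> 0 <= f.@[pt2 s t].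
Proof.
move=> [f0 [d d0 fgt0]]; exists d => // s t sa tb.
have [->|sNa] := eqVneq s a; last by apply/ltW/fgt0 => //; left.
have [->|tNb] := eqVneq t b; first by rewrite f0.
by apply/ltW/fgt0; rewrite ?subrr ?normr0 //; right.
Qed.

Lemma isolated_min_line f a b s t : isolated_min f a b ->
  exists2 d, 0 < d & forall e, 0 < e -> e < d ->
    0 <= (comp2 (s%:MP * X) (t%:MP * X) (comp2 (a%:MP + X) (b%:MP + Y) f)).@[pt2 e 0].
Proof.
move=> /isolated_min_ge0[d d0 fge0].
have st0 : 0 < `|s| + `|t| + 1 by rewrite ltr_wpDl // addr_ge0.
exists (d / (`|s| + `|t| + 1)); first by rewrite divr_gt0.
move=> e e0 ed; rewrite !meval_comp2 !meval2E.
move: ed; rewrite ltr_pdivlMr // => ed.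
have ns : 0 <= `|s| * e by rewrite mulr_ge0 // ltW.
have nt : 0 <= `|t| * e by rewrite mulr_ge0 // ltW.
apply: fge0; rewrite addrC addKr normrM (gtr0_norm e0); lra.
Qed.

(** The linear part is nonnegative on every line through the point, so it vanishes. *)
Lemma isolated_min_taylor2 f a b : isolated_min f a b ->
  exists k20 k11 k02, taylor2 f a b k20 k11 k02.
Proof.
move=> fmin.
pose G := comp2 (a%:MP + X) (b%:MP + Y) f.
have [g [h e]] := mpoly2_split0 G.
have G0 : G.@[pt2 0 0] = 0.
  by rewrite /G meval_comp2 !meval2E !addr0; case: fmin.
rewrite {}G0 mpolyC0 add0r in e.
have lin s t : 0 <= s * g.@[pt2 0 0] + t * h.@[pt2 0 0].
  pose L := s%:MP * comp2 (s%:MP * X) (t%:MP * X) g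
          + t%:MP * comp2 (s%:MP * X) (t%:MP * X) h.
  have -> : s * g.@[pt2 0 0] + t * h.@[pt2 0 0] = L.@[pt2 0 0].
    by rewrite /L !meval2E !meval_comp2 !meval2E !mulr0.
  have [d d0 dP] := isolated_min_line s t fmin.
  apply: (meval_ge0_closed d0) => x x0 xd; have := dP x x0 xd.
  rewrite -/G e !comp2E.
  have -> : s%:MP * X * comp2 (s%:MP * X) (t%:MP * X) g
    + t%:MP * X * comp2 (s%:MP * X) (t%:MP * X) h = X * L by rewrite /L; ring.
  by rewrite mevalM meval2X pmulr_rge0.
have g0 : g.@[pt2 0 0] = 0 by have := lin 1 0; have := lin (-1) 0; lra.
have h0 : h.@[pt2 0 0] = 0 by have := lin 0 1; have := lin 0 (-1); lra.
have [g1 [g2 eg]] := mpoly2_split0 g; have [h1 [h2 eh]] := mpoly2_split0 h.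
have [A [B1 eg1]] := mpoly2_split0 g1; have [B2 [C1 eg2]] := mpoly2_split0 g2.
have [B3 [C2 eh1]] := mpoly2_split0 h1; have [C3 [D eh2]] := mpoly2_split0 h2.
exists g1.@[pt2 0 0], (g2.@[pt2 0 0] + h1.@[pt2 0 0]), h2.@[pt2 0 0].
exists A, (B1 + B2 + B3), (C1 + C2 + C3), D.
rewrite -/G e eg eh g0 h0; move: eg1 eg2 eh1 eh2.
move: (g1.@[_]) (g2.@[_]) (h1.@[_]) (h2.@[_]) => x1 x2 x3 x4 -> -> -> ->.
by rewrite mpolyC0 mpolyCD; ring.
Qed.

Lemma isolated_min_psd f a b k20 k11 k02 : isolated_min f a b ->
  taylor2 f a b k20 k11 k02 -> forall s t, 0 <= quad k20 k11 k02 s t.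
Proof.
move=> fmin [A [B [C [D e]]]] s t.
pose cc := comp2 (s%:MP * X) (t%:MP * X).
pose L := k20%:MP * s%:MP ^+ 2 + k11%:MP * s%:MP * t%:MP + k02%:MP * t%:MP ^+ 2
  + X * (s%:MP ^+ 3 * cc A + s%:MP ^+ 2 * t%:MP * cc B + s%:MP * t%:MP ^+ 2 * cc C
       + t%:MP ^+ 3 * cc D).
have -> : quad k20 k11 k02 s t = L.@[pt2 0 0].
  by rewrite /L /quad !meval2E mul0r addr0.
have [d d0 dP] := isolated_min_line s t fmin.
apply: (meval_ge0_closed d0) => x x0 xd; have := dP x x0 xd.
rewrite e !comp2E -!/(cc _) (_ : _ + _ = X ^+ 2 * L); last by rewrite /L; ring.
by rewrite mevalM meval2Xn meval2X pmulr_rge0 // exprn_gt0.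
Qed.

Lemma psd_quad k20 k11 k02 : (forall s t, 0 <= quad k20 k11 k02 s t) ->
  [/\ 0 <= k20, 0 <= k02, k11 ^+ 2 <= 4 * k20 * k02 & 
    (k20 = 0 -> k11 = 0)].
Proof.
rewrite /quad => h; have k0 : 0 <= k20 by have := h 1 0; lra.
have k0' : 0 <= k02 by have := h 0 1; lra.
have e : k20 = 0 -> k11 = 0.
  move=> z; rewrite z in h; have [z'|z'] := eqVneq k02 0.
    have := h 1 (- k11); rewrite z' => h1; apply/eqP.
    by rewrite -sqrf_eq0 eq_le sqr_ge0 andbT; lra.
  have : 0 <= k02 * - k11 ^+ 2 by have := h (- 2 * k02) k11; lra.
  rewrite pmulr_rge0 ?lt0r ?z' // oppr_ge0 => h1.
  by apply/eqP; rewrite -sqrf_eq0 eq_le sqr_ge0 andbT.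
split=> //; have [z|z] := eqVneq k20 0.
  by rewrite z (e z) expr0n mulr0 mul0r.
(* At [(k11, - 2 k20)] the derivative along the first variable vanishes. *)
have : 0 <= k20 * (4 * k20 * k02 - k11 ^+ 2) by have := h k11 (- 2 * k20); lra.
by rewrite pmulr_rge0 ?lt0r ?z // subr_ge0.
Qed.

Lemma taylor2_swap f a b k20 k11 k02 : taylor2 f a b k20 k11 k02 ->
  taylor2 (comp2 Y X f) b a k02 k11 k20.
Proof.
move=> [A [B [C [D e]]]].
exists (comp2 Y X D), (comp2 Y X C), (comp2 Y X B), (comp2 Y X A).
have := congr1 (comp2 Y X) e; rewrite comp2_swap !comp2A !comp2E => ->; ring.
Qed.

Lemma isolated_min_swap f a b : isolated_min f a b ->
  isolated_min (comp2 Y X f) b a.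
Proof.
move=> [f0 [d d0 fgt0]]; split; first by rewrite meval_comp2 !meval2E.
exists d => // s t sb ta st; rewrite meval_comp2 !meval2E.
by apply: fgt0 => //; case: st; [right|left].
Qed.

Lemma taylor2_blowup f a b k20 k11 k02 : taylor2 f a b k20 k11 k02 ->
  exists r, comp2 (a%:MP + X * Y) (b%:MP + Y) f =
    Y ^+ 2 * (k20%:MP * X ^+ 2 + k11%:MP * X + k02%:MP + Y * r).
Proof.
move=> [A [B [C [D e]]]]; pose cc := comp2 (X * Y : {mpoly R[2]}) Y.
exists (X ^+ 3 * cc A + X ^+ 2 * cc B + X * cc C + cc D).
have := congr1 cc e; rewrite {1}/cc comp2A !comp2E => ->.
rewrite /cc !comp2E -!/(cc _); ring.
Qed.

End IsolatedMinimum.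

(** * Multiplicity, initial form and Hessian from the second order expansion *)

Lemma translate_pt2 (K : comNzRingType) (f : {mpoly K[2]}) (a b : K) :
  translate f (pt2 a b) = comp2 (a%:MP + X) (b%:MP + Y) f.
Proof.
rewrite /translate; congr (comp_mpoly _ f); apply: eq_from_tnth.
by move=> [[|[|//]] i2]; rewrite tnth_mktuple !(tnth_nth 0) /=; congr (_%:MP + 'X_ _);
  apply: val_inj.
Qed.

Section LowOrder.
Variable K : comNzRingType.
Implicit Types (f g h r Q : {mpoly K[2]}).

Definition order_gt d g := forall m, (mdeg m <= d)%N -> g@_m = 0.

Lemma order_gtD d g h : order_gt d g -> order_gt d h -> order_gt d (g + h).
Proof. by move=> g0 h0 m md; rewrite mcoeffD g0 ?h0 ?addr0. Qed.

Lemma order_gtM d e g h : g \is e.-homog -> (d < e)%N -> order_gt d (g * h).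
Proof.
move=> g_hom de m md; apply/memN_msupp_eq0/negP => /msuppM_le/allpairsP[[m1 m2]].
move=> /= [m1g _ em]; move: md; rewrite em mdegD leqNgt.
by rewrite (leq_trans de) // -(dhomog_mf g_hom m1g) leq_addr.
Qed.

Lemma homogU (i : 'I_2) : ('X_i : {mpoly K[2]}) \is 1.-homog.
Proof. by rewrite dhomogX /= mdeg1. Qed.

Lemma mem_order_gt d g m : order_gt d g -> m \in msupp g -> (d < mdeg m)%N.
Proof.
move=> gd mg; rewrite ltnNge; apply/negP => /gd.
by apply/eqP; rewrite -mcoeff_msupp.
Qed.

Lemma bigminn_leq (T : eqType) (s : seq T) (F : T -> nat) x0 m : m \in s ->
  (\big[minn/x0]_(k <- s) F k <= F m)%N.
Proof.
elim: s => // k s IH; rewrite inE big_cons => /orP[/eqP->|/IH]; first exact: geq_minl.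
by apply: leq_trans; exact: geq_minr.
Qed.

Lemma leq_bigminn (T : eqType) (s : seq T) (F : T -> nat) x0 d : (d <= x0)%N ->
  (forall m, m \in s -> (d <= F m)%N) -> (d <= \big[minn/x0]_(k <- s) F k)%N.
Proof.
move=> dx0; elim: s => [|k s IH] ds; rewrite ?big_nil // big_cons leq_min.
rewrite ds ?inE ?eqxx //=; apply: IH => m ms; apply: ds.
by rewrite inE ms orbT.
Qed.

Lemma order_gt_cubic (A B C D : {mpoly K[2]}) :
  order_gt 2 (X ^+ 3 * A + X ^+ 2 * Y * B + X * Y ^+ 2 * C + Y ^+ 3 * D).
Proof.
have X1 i := homogU i; have Xk i k := dhomogMn k (X1 i).
apply: order_gtD; last exact: order_gtM (Xk _ 3%N) _.
apply: order_gtD; last exact: order_gtM (dhomogM (X1 _) (Xk _ 2%N)) _.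
apply: order_gtD; last exact: order_gtM (dhomogM (Xk _ 2%N) (X1 _)) _.
exact: order_gtM (Xk _ 3%N) _.
Qed.

Definition quad_form (k20 k11 k02 : K) : {mpoly K[2]} :=
  k20%:MP * X ^+ 2 + k11%:MP * X * Y + k02%:MP * Y ^+ 2.

Lemma quad_form_homog k20 k11 k02 : quad_form k20 k11 k02 \is 2.-homog.
Proof.
have X1 i := homogU i; have Xk i k := dhomogMn k (X1 i).
rewrite /quad_form -mulrA !mul_mpolyC; apply: dhomogD; last exact: dhomogZ (Xk _ 2%N).
apply: dhomogD; apply: dhomogZ; first exact: (Xk _ 2%N).
exact: dhomogM (X1 _) (X1 _).
Qed.

Lemma order_gt_bigmin d g : order_gt d g -> g != 0 ->
  (d < \big[minn/msize g]_(k <- msupp g) mdeg k)%N.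
Proof.
move=> gd g0; apply: leq_bigminn => [|m /(mem_order_gt gd)//].
rewrite leqNgt; apply/negP => sg; move/negP: g0; apply.
rewrite -msupp_eq0; case em : (msupp g) => [//|m ms].
have mg : m \in msupp g by rewrite em inE eqxx.
have := mem_order_gt gd mg; have := msize_mdeg_lt mg.
move=> h1 h2; have := leq_ltn_trans h2 h1.
by rewrite ltnNge => /negP[]; apply: ltnW.
Qed.

End LowOrder.

Lemma det_mx2 (K : comNzRingType) (A : 'M[K]_2) :
  \det A = A 0 0 * A 1 1 - A 0 1 * A 1 0.
Proof.
rewrite (expand_det_row _ 0) big_ord_recl big_ord1 /cofactor !det_mx11 !mxE /=.
rewrite expr0 expr1 mul1r mulN1r mulrN.
by congr (_ * A _ _ - A _ _ * A _ _); apply: val_inj.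
Qed.

Section SosInterface.
Variable R : realType.
Implicit Types (f g h : {mpoly R[2]}) (a b s t : R).
Variables (f : {mpoly R[2]}) (a b k20 k11 k02 : R).
Hypothesis ft : taylor2 f a b k20 k11 k02.

Let ftE : exists2 r, order_gt 2 r &
  translate f (pt2 a b) = quad_form k20 k11 k02 + r.
Proof.
have [A [B [C [D e]]]] := ft.
exists (X ^+ 3 * A + X ^+ 2 * Y * B + X * Y ^+ 2 * C + Y ^+ 3 * D).
  exact: order_gt_cubic.
by rewrite translate_pt2 e /quad_form !addrA.
Qed.

Lemma quad_formE s t : (quad_form k20 k11 k02).@[pt2 s t] = quad k20 k11 k02 s t.
Proof. by rewrite /quad_form /quad !meval2E. Qed.

Lemma taylor2_multiplicity : k20 != 0 \/ k11 != 0 \/ k02 != 0 <->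
  multiplicity f (pt2 a b) = 2%N.
Proof.
rewrite /multiplicity; have [r r2 ->] := ftE; set Q := quad_form _ _ _.
have Q2 : Q \is 2.-homog by apply: quad_form_homog.
have [Q0|Q0] := eqVneq Q 0.
  split.
    have Q00 s t : quad k20 k11 k02 s t = 0 by rewrite -quad_formE -/Q Q0 meval0.
    have := Q00 1 0; have := Q00 0 1; have := Q00 1 1; rewrite /quad => h1 h2 h3.
    have -> : k20 = 0 by lra.
    have -> : k02 = 0 by lra.
    have -> : k11 = 0 by lra.
    by rewrite eqxx => -[|[|]].
  rewrite Q0 add0r; have [->|r0] := eqVneq r 0; first by rewrite msupp0 big_nil msize0.
  by move=> e; have := order_gt_bigmin r2 r0; rewrite e.
split=> _; last first.
  have [k200|] := eqVneq k20 0; last by left.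
  have [k110|] := eqVneq k11 0; last by right; left.
  have [k020|] := eqVneq k02 0; last by right; right.
  by move: Q0; rewrite /Q /quad_form k200 k110 k020 mpolyC0 !mul0r !addr0 eqxx.
have [m mQ] : exists m, m \in msupp Q.
  move: Q0; rewrite -msupp_eq0; case: (msupp Q) => [//|m ms] _.
  by exists m; rewrite inE eqxx.
have md : mdeg m = 2%N by apply: (dhomog_mf Q2).
have mQr : m \in msupp (Q + r).
  by rewrite mcoeff_msupp mcoeffD r2 ?md // addr0 -mcoeff_msupp.
have g1 : order_gt 1 (Q + r).
  apply: order_gtD => m' m'1; last by apply: r2; apply: leqW.
  by apply: (dhomog_nemf_coeff Q2); rewrite neq_ltn ltnS m'1.
apply/eqP; rewrite eqn_leq; apply/andP; split.
  by rewrite -[X in (_ <= X)%N]md bigminn_leq.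
apply: order_gt_bigmin => //; apply/eqP => g0; move: mQr.
by rewrite g0 msupp0.
Qed.

Hypothesis k_neq0 : k20 != 0 \/ k11 != 0 \/ k02 != 0.
Let mult2 : multiplicity f (pt2 a b) = 2%N.
Proof. exact/taylor2_multiplicity. Qed.

Lemma taylor2_initial_form s t :
  (initial_form f (pt2 a b)).@[pt2 s t] = quad k20 k11 k02 s t.
Proof.
rewrite /initial_form mult2; have [r r2 ->] := ftE.
rewrite pihomogD (pihomog_dE (quad_form_homog _ _ _)) pihomogE big1; last first.
  by move=> m /eqP md; rewrite r2 ?scale0r //= md.
by rewrite addr0 quad_formE.
Qed.

Lemma mderiv_translate g (i : 'I_2) :
  (comp2 (a%:MP + X) (b%:MP + Y) g)^`M(i) = comp2 (a%:MP + X) (b%:MP + Y) (g^`M(i)).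
Proof.
move: g; apply: mpoly2_ind => [c|||g h eg eh|g h eg eh].
- by rewrite comp_mpolyC !mderivC comp_mpoly0.
- by rewrite comp2X mderivD mderivC add0r mderivU comp_mpolyC.
- by rewrite comp2Y mderivD mderivC add0r mderivU comp_mpolyC.
- by rewrite !(comp_mpolyD, mderivD) eg eh.
by rewrite !(comp2M, mderivM, comp_mpolyD) eg eh.
Qed.

Lemma taylor2_hessianE i j : hessian f (pt2 a b) i j =
  k20 * 2 * ((j == 0)%:R * (i == 0)%:R) + k02 * 2 * ((j == 1)%:R * (i == 1)%:R)
  + k11 * ((j == 0)%:R * (i == 1)%:R + (j == 1)%:R * (i == 0)%:R).
Proof.
have -> : hessian f (pt2 a b) i j =
    ((translate f (pt2 a b))^`M(j)^`M(i)).@[pt2 0 0].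
  by rewrite mxE translate_pt2 !mderiv_translate meval_comp2 !meval2E !addr0.
have [A [B [C [D e]]]] := ft; rewrite translate_pt2 e !exprS !expr0 !mulr1.
rewrite !(mderivD, mderivM, mderivC, mderivU) !meval2E; ring.
Qed.

Lemma taylor2_hessian : \det (hessian f (pt2 a b)) = 4 * k20 * k02 - k11 ^+ 2.
Proof. by rewrite det_mx2 !taylor2_hessianE /=; ring. Qed.

Lemma sos_ordinary : k11 ^+ 2 != 4 * k20 * k02 -> sos_invariant f (pt2 a b) 1%:R.
Proof.
move=> disc; apply: SosOrdinary; split=> //.
by rewrite unitmxE taylor2_hessian unitfE subr_eq0 eq_sym.
Qed.

(** With multiplicity two, [m ^ 2 / 4 = 1]; a degenerate quadratic form leaves the
    single direction [t]. *)
Lemma sos_blowup (t : option R) (f' : {mpoly R[2]}) (n : nat) :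
  k11 ^+ 2 = 4 * k20 * k02 ->
  (forall t' : option R, t = t' <->
    quad k20 k11 k02 (if t' is Some c then c else 1) (if t' is Some _ then 1 else 0) = 0) ->
  (if t is Some _ then
     Y ^+ 2 * f' = comp2 (a%:MP + X * Y) (b%:MP + Y) f
   else X ^+ 2 * f' = comp2 (a%:MP + X) (b%:MP + X * Y) f) ->
  sos_invariant f' (inf_near_point t) n%:R ->
  sos_invariant f (pt2 a b) n.+1%:R.
Proof.
move=> disc tP f'E f'_sos.
have -> : n.+1%:R = (multiplicity f (pt2 a b))%:R ^+ 2 / 4
    + \sum_(t0 <- [:: t]) (n%:R : rat) :> rat.
  by rewrite mult2 big_seq1 -natr1 addrC; congr (_ + _).
apply: (SosBlowup (f' := fun _ => f') (q := fun _ => n%:R)) => //.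
- by case=> _; rewrite unitmxE taylor2_hessian disc subrr unitr0.
- move=> t'; rewrite /real_inf_near inE.
  have -> : (initial_form f (pt2 a b)).@[if t' is Some c then pt2 c 1 else pt2 1 0]
    = quad k20 k11 k02 (if t' is Some c then c else 1) (if t' is Some _ then 1 else 0).
    by case: (t') => [c|]; rewrite taylor2_initial_form.
  by split=> [/eqP ->|/tP ->]; [apply/tP|apply: eqxx].
- move=> t'; rewrite inE => /eqP ->; rewrite /strict_transform mult2.
  by case: t f'E {tP f'_sos}.
by move=> t'; rewrite inE => /eqP ->.
Qed.

End SosInterface.

(** * A Lojasiewicz inequality on the polar curve *)

(** The remainders of [1, p, ..., p^(size q)] modulo [q] are linearly dependent over
    the fraction field; the square matrix of coefficients below has a zero
    column, and [det0P] clears denominators. *)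
Lemma algebraic_modulo (D : idomainType) (p q : {poly D}) : q != 0 ->
  exists2 Q : {poly D}, Q != 0 & exists s, Q \Po p = q * s.
Proof.
move=> q0; have [n sq] : exists n, size q = n.+1.
  by exists (size q).-1; rewrite prednK // size_poly_gt0.
pose r i := (p ^+ i %% q)%R; pose c i := lead_coef q ^+ scalp (p ^+ i) q.
pose M := \matrix_(i < n.+1, j < n.+1) (r i)`_j.
have sr i : (size (r i) <= n)%N by rewrite -ltnS -sq /r Pdiv.Idomain.ltn_modp.
have /det0P[v v0 vM] : \det M == 0.
  rewrite (expand_det_col _ ord_max) big1 // => i _.
  by rewrite mxE nth_default ?mul0r.
have vr : \sum_(i < n.+1) v 0 i *: r i = 0.
  apply/polyP => j; rewrite coef0 coef_sum.
  have [jn|nj] := ltnP j n.+1; last first.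
    rewrite big1 // => i _; rewrite coefZ nth_default ?mulr0 //.
    by rewrite (leq_trans (sr i)) // ltnW.
  have /rowP/(_ (Ordinal jn)) := vM; rewrite !mxE => e; rewrite -[RHS]e.
  by apply: eq_bigr => i _; rewrite coefZ mxE.
exists (\poly_(i < n.+1) (if insub i is Some i' then v 0 i' * c i else 0)).
  have [i vi] : exists i, v 0 i != 0.
    apply/existsP; apply: contraNT v0; rewrite negb_exists => /forallP h.
    by apply/eqP/rowP => i; rewrite mxE; apply/eqP; move: (h i); rewrite negbK.
  apply/eqP => /polyP/(_ i); rewrite coef_poly coef0 ltn_ord valK => /eqP.
  by rewrite mulf_eq0 (negPf vi) expf_eq0 lead_coef_eq0 (negPf q0) andbF.
exists (\sum_(i < n.+1) v 0 i *: (p ^+ i %/ q)%R).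
rewrite poly_def raddf_sum mulr_sumr /=.
rewrite -[RHS]addr0 -[X in _ = _ + X]vr -big_split /=.
apply: eq_bigr => i _; rewrite valK linearZ /= rmorphXn /= comp_polyX.
by rewrite -scalerA /c Pdiv.Idomain.divp_eq scalerDr -scalerAr [q * _]mulrC.
Qed.

Section CriticalBound.
Variable R : realType.
Implicit Types (f g h : {mpoly R[2]}) (a b s t : R).

(** The bound is imposed on the polar curve only: a blowing-up maps the polar curve of
    the strict transform to that of [f], so the exponent can be followed. *)
Definition crit_bound f a b N := exists C d, [/\ 0 < C, 0 < d &
  forall s t, `|s - a| < d -> `|t - b| < d -> t != b ->
    (f^`M(0)).@[pt2 s t] = 0 -> C * `|t - b| ^+ N <= f.@[pt2 s t]].

(** On the polar curve the value [z = f(s, t)] satisfies an equation with coefficients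
    polynomial in [t].  As [z > 0], powers of [z] may be divided out, and the constant
    coefficient, which behaves like a power of [t - b], is at most a constant
    times [z]. *)
Lemma isolated_min_crit_bound f a b : isolated_min f a b -> f^`M(0) != 0 ->
  exists N, crit_bound f a b N.
Proof.
move=> [f0 [d d0 f_gt0]] fx0.
have q0 : bivar_inv (f^`M(0)) != 0.
  by apply: contraNneq fx0 => /(congr1 (@bivar R)); rewrite bivar_invK rmorph0 => ->.
have [Q Q0 [s0 eQ]] := algebraic_modulo (bivar_inv f) q0.
have [j [Q1]] := multiplicity_XsubC Q 0; rewrite Q0 /= => Q1r eQ1.
have [Q2 eQ2] : exists Q2, Q1 - Q1.[0]%:P = Q2 * ('X - 0%:P).
  by apply/factor_theorem; rewrite /root hornerD hornerN hornerC subrr.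
have [N [W]] := multiplicity_XsubC Q1.[0] b; rewrite Q1r /= => Wb VE.
have [M M0 MP] := meval_bounded (comp2 f Y (bivar Q2)) a b.
pose w := `|W.[b]| / 2.
have w0 : 0 < w by rewrite divr_gt0 ?normr_gt0.
have [|d' d'0 Wnear] := @meval_near_gt0 R (poly_in_Y W ^+ 2 - (w ^+ 2)%:MP) a b.
  have Wb0 : 0 < `|W.[b]| ^+ 2 by rewrite exprn_gt0 ?normr_gt0.
  rewrite mevalB meval2Xn mevalC meval_poly_in_Y /w expr_div_n.
  by rewrite -[W.[b] ^+ 2]real_normK ?num_real //; lra.
exists N, (w / M), (Num.min 1 (Num.min d d')); split.
- by rewrite divr_gt0.
- by rewrite !lt_min ltr01 d0.
move=> s t; rewrite !lt_min => /and3P[sa1 sad sad'] /and3P[tb1 tbd tbd'] tNb fx.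
set z := f.@[pt2 s t].
have z0 : 0 < z by apply: f_gt0 => //; right.
have ez : (bivar Q).@[pt2 z t] = 0.
  rewrite meval_bivar /z -[f]bivar_invK meval_bivar -horner_comp -map_comp_poly.
  by rewrite eQ -meval_bivar (rmorphM (@bivar R)) mevalM /= bivar_invK fx mul0r.
have {ez} ez1 : (bivar Q1).@[pt2 z t] = 0.
  move/eqP: ez; rewrite meval_bivar eQ1 rmorphM rmorphXn subr0 /= map_polyX.
  rewrite hornerM horner_exp hornerX mulf_eq0 expf_eq0 (gt_eqF z0) andbF orbF.
  by rewrite -meval_bivar => /eqP.
have eV : Q1.[0].[t] = - ((comp2 f Y (bivar Q2)).@[pt2 s t] * z).
  rewrite meval_comp2 meval2Y -/z -[z in _ * z](hornerX z).
  rewrite meval_bivar in ez1; rewrite meval_bivar -(map_polyX (horner_eval t)).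
  rewrite -hornerM -rmorphM -['X]subr0 -(polyC0) -eQ2 rmorphB hornerD hornerN /=.
  by rewrite ez1 map_polyC hornerC sub0r opprK.
have Wt : w <= `|W.[t]|.
  have := Wnear s t sad' tbd'.
  rewrite mevalB meval2Xn mevalC meval_poly_in_Y subr_gt0.
  rewrite -[W.[t] ^+ 2]real_normK ?num_real // ltr_pXn2r ?nnegrE ?(ltW w0) //.
  exact: ltW.
rewrite mulrAC ler_pdivrMr //.
apply: (@le_trans _ _ (`|W.[t]| * `|t - b| ^+ N)).
  by rewrite ler_wpM2r // exprn_ge0.
have {}VE : Q1.[0].[t] = W.[t] * (t - b) ^+ N.
  by rewrite VE hornerM horner_exp hornerXsubC.
rewrite -normrX -normrM -VE eV normrN normrM (gtr0_norm z0) [z * M]mulrC.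
by apply: ler_wpM2r; [apply: ltW|apply: MP; apply: ltW].
Qed.

Section Blowup.
Variables (f h : {mpoly R[2]}) (a b : R).
Hypothesis fh : comp2 (a%:MP + X * Y) (b%:MP + Y) f = Y ^+ 2 * h.

Lemma blowup_eval s t : f.@[pt2 (a + s * t) (b + t)] = t ^+ 2 * h.@[pt2 s t].
Proof.
have := congr1 (meval (pt2 s t)) fh.
by rewrite meval_comp2 mevalM meval2Xn meval2Y => <-; rewrite !meval2E.
Qed.

Lemma mderiv_blowup g : (comp2 (a%:MP + X * Y) (b%:MP + Y) g)^`M(0) =
  Y * comp2 (a%:MP + X * Y) (b%:MP + Y) (g^`M(0)).
Proof.
move: g; apply: mpoly2_ind => [c|||g k eg ek|g k eg ek].
- by rewrite comp_mpolyC !mderivC comp_mpoly0 mulr0.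
- rewrite comp2X mderivD mderivM mderivC !mderivU comp_mpolyC /= mpolyC0 mulr0.
  by rewrite mpolyC1; ring.
- by rewrite comp2Y mderivD mderivC add0r mderivU comp_mpolyC /= mpolyC0 mulr0.
- by rewrite !(comp_mpolyD, mderivD) eg ek mulrDr.
by rewrite !(comp2M, mderivM, comp_mpolyD) eg ek; ring.
Qed.

Lemma mderiv_blowup_eval s t : t != 0 ->
  (f^`M(0)).@[pt2 (a + s * t) (b + t)] = t * (h^`M(0)).@[pt2 s t].
Proof.
move=> t0; have := mderiv_blowup f; rewrite fh.
have -> : (Y ^+ 2 * h)^`M(0) = Y * Y * h^`M(0).
  by rewrite expr2 !mderivM mderivU /= mpolyC0; ring.
move=> /(congr1 (meval (pt2 s t))).
rewrite !mevalM meval_comp2 !meval2Y -mulrA => /(mulfI t0) ->.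
by rewrite !meval2E.
Qed.

Lemma blowup_box c d : 0 < d -> exists2 d', 0 < d' <= 1 & forall s t,
  `|s - c| <= 1 -> `|t| < d' ->
  `|(a + s * t) - a| < d /\ `|(b + t) - b| < d.
Proof.
move=> d0; have c0 : 0 < `|c| + 1 by rewrite ltr_wpDl.
exists (Num.min 1 (d / (`|c| + 1))).
  by rewrite lt_min ltr01 divr_gt0 // ge_min lexx.
move=> s t sc; rewrite lt_min => /andP[_ td].
rewrite ![_ + _ - _]addrAC !subrr !add0r normrM.
have sc1 : `|s| <= `|c| + 1.
  by rewrite -(subrK c s) addrC (le_trans (ler_normD _ _)) // lerD2l.
move: td; rewrite ltr_pdivlMr // => td; split.
  by rewrite (le_lt_trans _ td) // mulrC ler_wpM2l.
by rewrite (le_lt_trans _ td) // ler_peMr // lerDr.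
Qed.

Lemma crit_bound_blowup c N : crit_bound f a b N.+2 -> crit_bound h c 0 N.
Proof.
move=> [C [d [C0 d0 CP]]]; have [d' /andP[d'0 d'1] box] := blowup_box c d0.
exists C, d'; split=> // s t sc; rewrite subr0 => t0d tN0 hx.
have [sad tbd] := box s t (ltW (lt_le_trans sc d'1)) t0d.
have t2 : 0 < t ^+ 2 by rewrite exprn_even_gt0.
rewrite -(ler_pM2l t2) -blowup_eval.
have tb : b + t - b = t by rewrite addrAC subrr add0r.
have := CP _ _ sad tbd; rewrite tb mderiv_blowup_eval // hx mulr0.
rewrite -subr_eq0 tb => /(_ tN0 erefl); apply: le_trans.
have -> : `|t| ^+ N.+2 = `|t| ^+ N * t ^+ 2.
  by rewrite 2!exprSr -mulrA -expr2 real_normK ?num_real.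
rewrite (_ : t ^+ 2 * _ = C * (`|t| ^+ N * t ^+ 2)) //; ring.
Qed.

Lemma isolated_min_blowup k20 k11 k02 c : isolated_min f a b -> 0 < k20 ->
  k11 ^+ 2 = 4 * k20 * k02 -> c = - k11 / (2 * k20) ->
  (forall s, h.@[pt2 s 0] = quad k20 k11 k02 s 1) -> isolated_min h c 0.
Proof.
move=> [f0 [d d0 fgt0]] k0 disc ec h0.
have hs s : h.@[pt2 s 0] = k20 * (s - c) ^+ 2.
  rewrite h0 /quad ec; have -> : k02 = k11 ^+ 2 / (4 * k20).
    by rewrite disc mulrAC mulfV ?mul1r // mulf_neq0 ?gt_eqF.
  by field; rewrite gt_eqF.
split; first by rewrite hs subrr expr0n mulr0.
have [d' /andP[d'0 d'1] box] := blowup_box c d0.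
exists d' => // s t sc; rewrite subr0 => t0d st.
have [sad tbd] := box s t (ltW (lt_le_trans sc d'1)) t0d.
have [t0|tN0] := eqVneq t 0.
  rewrite t0 in st *; rewrite hs mulr_gt0 //.
  by rewrite exprn_even_gt0 //= subr_eq0; case: st; rewrite ?eqxx.
have t2 : 0 < t ^+ 2 by rewrite exprn_even_gt0.
rewrite -(pmulr_rgt0 _ t2) -blowup_eval; apply: fgt0 => //; right.
by rewrite -subr_eq0 addrAC subrr add0r.
Qed.

(** The polar curve of the strict transform meets every line close to the exceptional
    one, by the intermediate value theorem on [c - 1, c + 1], where [c] is the
    double root of the tangent direction.  There [f = t^2 h] with [h] bounded, which is
    too small for an exponent below two. *)
Lemma crit_bound_ge2 k20 k11 k02 r N : 0 < k20 ->
  h = k20%:MP * X ^+ 2 + k11%:MP * X + k02%:MP + Y * r ->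
  crit_bound f a b N -> (2 <= N)%N.
Proof.
move=> k0 hE [C [d [C0 d0 CP]]]; rewrite leqNgt; apply/negP => N2.
pose c := - k11 / (2 * k20).
have hx s : (h^`M(0)).@[pt2 s 0] = 2 * k20 * s + k11.
  rewrite hE !expr2 !(mderivD, mderivM, mderivC, mderivU) !meval2E /=; ring.
have kc : 2 * k20 * c = - k11 by rewrite /c mulrC mulfVK // mulf_neq0 ?gt_eqF.
have [|d1 d10 near1] := @meval_near_gt0 R (h^`M(0)) (c + 1) 0.
  by rewrite hx mulrDr kc; lra.
have [|d2 d20 near2] := @meval_near_gt0 R (- h^`M(0)) (c - 1) 0.
  by rewrite mevalN hx mulrBr kc; lra.
have [d' /andP[d'0 d'1] box] := blowup_box c d0.
have [M M0 hM] := meval_bounded h c 0.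
pose m := Num.min (Num.min d1 d2) (Num.min d' (C / M)).
have m0 : 0 < m by rewrite !lt_min d10 d20 d'0 divr_gt0.
pose t := m / 2.
have t0 : 0 < t by rewrite divr_gt0.
have : t < m by rewrite /t ltr_pdivrMr // ltr_pMr // ltr1n.
rewrite !lt_min => /andP[/andP[td1 td2] /andP[td' tC]].
have tn : `|t| = t by rewrite gtr0_norm.
pose q := map_poly (horner_eval t) (bivar_inv (h^`M(0))).
have qE s : q.[s] = (h^`M(0)).@[pt2 s t] by rewrite -meval_bivar bivar_invK.
have [||u /andP[u1 u2] /rootP] := @poly_ivt R q (c - 1) (c + 1).
- by lra.
- have := near1 (c + 1) t; rewrite subrr normr0 subr0 tn => /(_ d10 td1) h1.
  have := near2 (c - 1) t; rewrite subrr normr0 subr0 tn mevalN => /(_ d20 td2) h2.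
  by rewrite !qE; apply/andP; split; lra.
rewrite qE => hu0; have uc : `|u - c| <= 1 by rewrite ler_norml; lra.
have [sad tbd] : `|(a + u * t) - a| < d /\ `|(b + t) - b| < d by apply: box; rewrite ?tn.
have tb : b + t - b = t by rewrite addrAC subrr add0r.
have := CP _ _ sad tbd; rewrite tb (mderiv_blowup_eval u (lt0r_neq0 t0)) hu0.
rewrite mulr0 -subr_eq0 tb => /(_ (lt0r_neq0 t0) erefl); rewrite blowup_eval tn.
have hut : h.@[pt2 u t] <= M.
  have : `|h.@[pt2 u t]| <= M by apply: hM; rewrite // subr0 tn (le_trans (ltW td')).
  by rewrite ler_norml => /andP[].
have t1 : t <= 1 by apply: le_trans d'1; apply: ltW.
have tN : t <= t ^+ N.
  by case: N N2 {CP} => [|[|//]] _; rewrite ?expr0 ?expr1.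
move=> CtN; move: tC; rewrite ltr_pdivlMr // => tC.
have e1 : C * t <= C * t ^+ N by rewrite ler_pM2l.
have e2 : t ^+ 2 * h.@[pt2 u t] <= t ^+ 2 * M by rewrite ler_pM2l // exprn_gt0.
have : t * C <= t * (t * M) by rewrite mulrA -expr2 mulrC; lra.
by rewrite ler_pM2l //; lra.
Qed.

End Blowup.

(** Dividing the restriction to [Y = 0] by [s ^ 2] and letting [s] tend to zero. *)
Lemma taylor2_lead h c k k20 k11 k02 : taylor2 h c 0 k20 k11 k02 ->
  (forall s, h.@[pt2 s 0] = k * (s - c) ^+ 2) -> k20 = k.
Proof.
move=> [A [B [C [D e]]]] hs.
have eA s : s != 0 -> (k20%:MP - k%:MP + X * A).@[pt2 s 0] = 0.
  move=> s0; have := congr1 (meval (pt2 s 0)) e.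
  rewrite meval_comp2 !meval2E !addr0 hs addrAC subrr add0r => e'.
  apply: (mulfI (mulf_neq0 s0 s0)); rewrite mulr0; lra.
have h1 : 0 <= (k20%:MP - k%:MP + X * A).@[pt2 0 0].
  by apply: (meval_ge0_closed ltr01) => s s0 _; rewrite eA ?gt_eqF.
have h2 : 0 <= (- (k20%:MP - k%:MP + X * A)).@[pt2 0 0].
  by apply: (meval_ge0_closed ltr01) => s s0 _; rewrite mevalN eA ?oppr0 ?gt_eqF.
move: h1 h2; rewrite !meval2E mul0r; lra.
Qed.

End CriticalBound.

(** * The recursion along the blowing-ups *)

Section Recursion.
Variable R : realType.
Implicit Types (f g h : {mpoly R[2]}) (a b : R).

Definition strict_quad (k20 k11 k02 : R) r : {mpoly R[2]} :=
  k20%:MP * X ^+ 2 + k11%:MP * X + k02%:MP + Y * r.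

Lemma strict_quad_at (k20 k11 k02 : R) r s :
  (strict_quad k20 k11 k02 r).@[pt2 s 0] = quad k20 k11 k02 s 1.
Proof. by rewrite /strict_quad /quad !meval2E; ring. Qed.

Lemma quad_square (k20 k11 k02 s : R) : 0 < k20 -> k11 ^+ 2 = 4 * k20 * k02 ->
  quad k20 k11 k02 s 1 = k20 * (s - (- k11 / (2 * k20))) ^+ 2.
Proof.
move=> k0 disc; rewrite /quad.
have -> : k02 = k11 ^+ 2 / (4 * k20).
  by rewrite disc mulrAC mulfV ?mul1r // mulf_neq0 ?gt_eqF.
by field; rewrite gt_eqF.
Qed.

Lemma contact_blowup f h a b c n :
  comp2 (a%:MP + X * Y) (b%:MP + Y) f = Y ^+ 2 * h ->
  contact h c 0 n -> contact f a b n.+1.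
Proof.
move=> fr hcont.
have [phi [g [e [be [ga [[phiY phi0] eg e0 d0 gE]]]]]] := hcont.
exists (Y * (c%:MP + phi)), g, e, be, ga; split=> //.
  by rewrite !comp2E phiY !meval2E mul0r.
rewrite mpolyC0 add0r in eg.
transitivity (comp2 (c%:MP + phi + Y ^+ n * X) Y
    (comp2 (a%:MP + X * Y) (b%:MP + Y) f)).
  rewrite comp2A !comp2E (_ : a%:MP + Y * _ + _ =
    a%:MP + (c%:MP + phi + Y ^+ n * X) * Y) //.
  by rewrite (exprS _ n); ring.
by rewrite fr comp2M comp2Xn comp2Y eg (exprS _ n); ring.
Qed.

(** As long as the coefficient of [X ^ 2] is positive the recursion stays in the first
    chart, and each step lowers the exponent in [crit_bound] by two. *)
Theorem sos_contact N f a b k20 k11 k02 : isolated_min f a b ->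
  taylor2 f a b k20 k11 k02 -> 0 < k20 -> crit_bound f a b N ->
  exists n, [/\ (0 < n)%N, sos_invariant f (pt2 a b) n%:R & contact f a b n].
Proof.
have [m] := ubnP N; elim: m N f a b k11 k02 => // m IH N f a b k11 k02 Nm.
move=> fmin ft k0 crit; have kn : k20 != 0 \/ k11 != 0 \/ k02 != 0.
  by left; rewrite gt_eqF.
have [_ _ psd _] := psd_quad (isolated_min_psd fmin ft).
have [r fr] := taylor2_blowup ft; rewrite -/(strict_quad k20 k11 k02 r) in fr.
have [disc|disc] := eqVneq (k11 ^+ 2) (4 * k20 * k02); last first.
  exists 1%N; split=> //; first exact: (sos_ordinary ft kn disc).
  exists 0, (strict_quad k20 k11 k02 r), k20, k11, k02; split=> //.
  - by rewrite comp_mpoly0 meval0.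
  - by rewrite addr0 !expr1 mulrC fr.
  - by rewrite lt_neqAle disc psd.
  by move=> u; rewrite strict_quad_at /quad; ring.
have N2 := crit_bound_ge2 fr k0 (erefl _) crit.
pose c := - k11 / (2 * k20); set h := strict_quad _ _ _ _ in fr.
have h0 s : h.@[pt2 s 0] = k20 * (s - c) ^+ 2 by rewrite strict_quad_at quad_square.
have hmin : isolated_min h c 0.
  by apply: (isolated_min_blowup fr fmin k0 disc (erefl _)) => s; rewrite strict_quad_at.
have [k20' [k11' [k02' ht]]] := isolated_min_taylor2 hmin.
have ek := taylor2_lead ht h0; rewrite ek in ht.
have critN : crit_bound f a b N.-2.+2 by case: N N2 crit {Nm} => [|[|N]].
have [||n [n0 hsos hcont]] := IH N.-2 h c 0 k11' k02' _ hmin ht k0.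
- by case: N N2 Nm {crit critN} => [|[|N]] // _ /ltnW.
- exact: (crit_bound_blowup fr c critN).
exists n.+1; split=> //.
  apply: (sos_blowup ft kn (t := Some c) disc _ _ hsos) => //.
  - case=> [c'|].
      rewrite quad_square // -/c; split=> [[->]|/eqP].
        by rewrite subrr expr0n mulr0.
      rewrite mulf_eq0 gt_eqF //= sqrf_eq0 subr_eq0 => /eqP ->//.
    split=> //; rewrite /quad; move/eqP; rewrite expr1n expr0n !mulr0 !mulr1 !addr0.
    by rewrite gt_eqF.
exact: contact_blowup fr hcont.
Qed.

Lemma taylor2_crit_bound f a b k20 k11 k02 : isolated_min f a b ->
  taylor2 f a b k20 k11 k02 -> 0 < k20 -> exists N, crit_bound f a b N.
Proof.
move=> fmin ft k0; apply: isolated_min_crit_bound => //.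
apply/eqP => fx0; have := taylor2_hessianE ft 0 0.
by rewrite mxE fx0 mderiv0 meval0 /=; lra.
Qed.

(** The converse of [contact_blowup] when the tangent direction is [X = 0].  Contact of
    order one would make [h] positive on the whole exceptional line. *)
Lemma contact_blowdown f h a b k n : k != 0 ->
  comp2 (a%:MP + X * Y) (b%:MP + Y) f = Y ^+ 2 * h ->
  (forall s, h.@[pt2 s 0] = k * s ^+ 2) ->
  contact f a b n.+1 -> (0 < n)%N /\ contact h 0 0 n.
Proof.
move=> k0 fr h0 [phi [g [e [be [ga [[phiY phi0] eg e0 disc gE]]]]]].
have [psi epsi] := mpoly2_divY phi.
have {}epsi : phi = Y * psi.
  by rewrite epsi -{1}phiY comp2A !comp2E comp2_00 phi0 mpolyC0 add0r.
have psiY : comp2 0 Y psi = psi.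
  apply: (mulfI (mpolyX_neq0 R 1)).
  by rewrite -{1}(comp2Y 0 Y) -comp2M -epsi phiY.
have eh : comp2 (psi + Y ^+ n * X) Y h = Y ^+ n ^+ 2 * g.
  have Y2 : Y ^+ 2 != 0 :> {mpoly R[2]} by rewrite expf_neq0 ?mpolyX_neq0.
  apply: (mulfI Y2).
  transitivity (comp2 (psi + Y ^+ n * X) Y (comp2 (a%:MP + X * Y) (b%:MP + Y) f)).
    by rewrite fr comp2M comp2Xn comp2Y.
  rewrite comp2A !comp2E (_ : a%:MP + _ * Y = a%:MP + phi + Y ^+ n.+1 * X).
    by rewrite eg (exprS _ n); ring.
  by rewrite epsi (exprS _ n); ring.
have psiE u : psi.@[pt2 u 0] = psi.@[pt2 0 0].
  by rewrite -psiY !meval_comp2 !meval2E.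
have ev u : k * (psi.@[pt2 0 0] + 0 ^+ n * u) ^+ 2 =
    0 ^+ n ^+ 2 * (e * u ^+ 2 + be * u + ga).
  have := congr1 (meval (pt2 u 0)) eh.
  rewrite meval_comp2 mevalM mevalD mevalM !meval2Xn !meval2Y meval2X psiE.
  by rewrite h0 gE.
case: n ev eh {eg} => [|n] ev eh.
  have := ev (- psi.@[pt2 0 0]); rewrite !expr0 mul1r subrr expr0n mulr0 expr1n mul1r.
  set u := - _ => eq0.
  have : 0 <= (2 * e * u + be) ^+ 2 by apply: sqr_ge0.
  have : 4 * e * (e * u ^+ 2 + be * u + ga) = 0 by rewrite -eq0 mulr0.
  by lra.
split=> //; exists psi, g, e, be, ga; split=> //; last by rewrite mpolyC0 !add0r.
split=> //; have /eqP := ev 0; rewrite mulr0 addr0 [0 ^+ n.+1]exprS mul0r.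
by rewrite expr0n mul0r mulf_eq0 (negPf k0) sqrf_eq0 => /eqP.
Qed.

Lemma pt2_eta (T : Type) (x : 'I_2 -> T) : x = pt2 (x 0) (x 1).
Proof.
apply: funext => -[[|[|//]] i2]; rewrite /pt2 (tnth_nth (x 0)) /=;
  by congr (x _); apply: val_inj.
Qed.

Lemma contact_delta_complex f a b n : (0 < n)%N -> contact f a b n ->
  delta_invariant (complexify f) (complex_point (pt2 a b)) n.
Proof.
move=> n0 fc; rewrite [complex_point _]pt2_eta.
exact: (@contact_delta R R[i] (real_complex R) 'i%C (sqr_i R) f a b n n0 fc).
Qed.

Lemma contact_swap_delta_complex f a b n : (0 < n)%N ->
  contact (comp2 Y X f) b a n ->
  delta_invariant (complexify f) (complex_point (pt2 a b)) n.
Proof.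
move=> n0 fc; rewrite [complex_point _]pt2_eta.
exact: (@contact_swap_delta R R[i] (real_complex R) 'i%C (sqr_i R) f a b n n0 fc).
Qed.

(** The order of contact does not depend on the coordinate used to measure it, as both
    orders are equal to delta. *)
Lemma contact_swap_eq f a b m n : (0 < m)%N -> (0 < n)%N ->
  contact f a b m -> contact (comp2 Y X f) b a n -> m = n.
Proof.
move=> m0 n0 /(contact_delta_complex m0) dm /(contact_swap_delta_complex n0).
exact: delta_unique dm.
Qed.

(** As long as the tangent direction is horizontal the recursion follows the second
    chart, and contact is measured along the first coordinate; as soon as it is not,
    [sos_contact] takes over. *)
Lemma sos_of_contact_swap n f a b k20 k11 k02 : isolated_min f a b ->
  taylor2 f a b k20 k11 k02 -> 0 < k02 -> (0 < n)%N ->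
  contact (comp2 Y X f) b a n -> sos_invariant f (pt2 a b) n%:R.
Proof.
elim: n f a b k20 k11 k02 => // n IH f a b k20 k11 k02 fmin ft k02_gt0 n0 fcont.
have [k20_ge0 _ psd k11_0] := psd_quad (isolated_min_psd fmin ft).
have [k20_0|k20N0] := eqVneq k20 0; last first.
  have k20_gt0 : 0 < k20 by rewrite lt_neqAle eq_sym k20N0.
  have [N crit] := taylor2_crit_bound fmin ft k20_gt0.
  have [m [m0 fsos fcont']] := sos_contact fmin ft k20_gt0 crit.
  by rewrite -(contact_swap_eq m0 n0 fcont' fcont).
have k110 := k11_0 k20_0; rewrite k20_0 k110 in ft.
have fst := taylor2_swap ft; have fsmin := isolated_min_swap fmin.
have [r fr] := taylor2_blowup fst; rewrite -/(strict_quad k02 0 0 r) in fr.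
move: (strict_quad_at k02 0 0 r) fr; move: (strict_quad k02 0 0 r) => h h0 fr.
have hs s : h.@[pt2 s 0] = k02 * s ^+ 2 by rewrite h0 /quad; ring.
have [n'0 hcont] := contact_blowdown (lt0r_neq0 k02_gt0) fr hs fcont.
have hmin : isolated_min h 0 0.
  apply: (isolated_min_blowup fr fsmin k02_gt0 _ _ h0); first by rewrite expr0n mulr0.
  by rewrite oppr0 mul0r.
have [l20 [l11 [l02 ht]]] := isolated_min_taylor2 hmin.
have el : l20 = k02 by apply: (taylor2_lead ht) => s; rewrite hs subr0.
rewrite el in ht.
have kn : (0 : R) != 0 \/ (0 : R) != 0 \/ k02 != 0 by right; right; rewrite lt0r_neq0.
apply: (sos_blowup ft kn (t := None) (f' := comp2 Y X h)).
- by rewrite expr0n mulr0 mul0r.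
- case=> [c|]; last by split=> // _; rewrite /quad expr0n !mulr0 mul0r !addr0.
  split=> // /eqP; rewrite /quad !mul0r !add0r expr1n mulr1.
  by rewrite (negPf (lt0r_neq0 k02_gt0)).
- have := congr1 (comp2 Y X) fr; rewrite [comp2 Y X (Y ^+ 2 * h)]comp2M.
  rewrite comp2Xn comp2Y => <-; rewrite comp2_swap comp2A !comp2E.
  by rewrite (mulrC Y X).
apply: (IH _ 0 0 l02 l11 k02) => //.
- exact: isolated_min_swap.
- exact: taylor2_swap ht.
by rewrite comp2_swap comp2_id.
Qed.

Theorem sos_eq_delta f a b : isolated_min f a b -> multiplicity f (pt2 a b) = 2%N ->
  exists n, delta_invariant (complexify f) (complex_point (pt2 a b)) n /\
    sos_invariant f (pt2 a b) n%:R.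
Proof.
move=> fmin mult2; have [k20 [k11 [k02 ft]]] := isolated_min_taylor2 fmin.
have kn := (taylor2_multiplicity ft).2 mult2.
have [k20_ge0 k02_ge0 psd k11_0] := psd_quad (isolated_min_psd fmin ft).
have [k20_0|k20N0] := eqVneq k20 0; last first.
  have k20_gt0 : 0 < k20 by rewrite lt_neqAle eq_sym k20N0.
  have [N crit] := taylor2_crit_bound fmin ft k20_gt0.
  have [n [n0 fsos fcont]] := sos_contact fmin ft k20_gt0 crit.
  by exists n; split=> //; apply: contact_delta_complex.
have k02_gt0 : 0 < k02.
  rewrite lt_neqAle k02_ge0 andbT eq_sym.
  by move: kn; rewrite k20_0 (k11_0 k20_0) eqxx => -[|[|]].
have fst := taylor2_swap ft; have fsmin := isolated_min_swap fmin.
have [N crit] := taylor2_crit_bound fsmin fst k02_gt0.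
have [n [n0 _ fcont]] := sos_contact fsmin fst k02_gt0 crit.
exists n; split; first exact: contact_swap_delta_complex.
exact: sos_of_contact_swap fmin ft k02_gt0 n0 fcont.
Qed.

Lemma dhomog_meval_scale m d (P : {mpoly R[m]}) (c : R) (Z : 'I_m -> R) :
  P \is d.-homog -> P.@[fun i => c * Z i] = c ^+ d * P.@[Z].
Proof.
move=> /dhomogP homP; rewrite !mevalE mulr_sumr; apply: eq_big_seq => k /homP <-.
rewrite mulrCA; congr (_ * _); rewrite /= mdegE -prodrXr -big_split /=.
by apply: eq_bigr => i _; rewrite exprMn.
Qed.

(** A zero of the dehomogenization near the point gives, scaled by [Z k], a zero of [P]
    near [Z], which is then proportional to [Z] with factor one. *)
Lemma isolated_min_dehomogenize d (P : {mpoly R[3]}) (Z : 'I_3 -> R) (k : 'I_3) :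
  nonneg_form d P -> isolated_real_zero P Z -> Z k != 0 ->
  isolated_min (dehomogenize k P) (affine_point k Z 0) (affine_point k Z 1).
Proof.
move=> [homP P_ge0] [PZ [e e0 Ziso]] Zk.
pose ext (y : 'I_2 -> R) i := if unlift k i is Some j then y j else 1.
have ev y : (dehomogenize k P).@[y] = P.@[ext y].
  rewrite comp_mpoly_meval; apply: meval_eq => i.
  by rewrite tnth_mktuple /ext; case: unlift => [j|]; rewrite ?mevalXU ?meval1.
have ev0 y : (P.@[ext y] == 0) = (P.@[fun i => Z k * ext y i] == 0).
  by rewrite (dhomog_meval_scale _ _ homP) mulf_eq0 expf_eq0 (negPf Zk) andbF.
split.
  rewrite -pt2_eta ev; apply/eqP; rewrite ev0 -PZ; apply/eqP/meval_eq => i.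
  rewrite /ext; case: unliftP => [j ->|->]; last by rewrite mulr1.
  by rewrite /affine_point mulrCA mulfV ?mulr1.
exists (e / `|Z k|); first by rewrite divr_gt0 ?normr_gt0.
move=> s t sa tb st; rewrite lt_neqAle ev P_ge0 andbT eq_sym ev0.
apply/negP => /eqP PY.
have [|c cP] := Ziso _ _ PY.
  move=> i; rewrite /ext; case: unliftP => [j ->|->]; last by rewrite mulr1 subrr normr0.
  have -> : Z k * pt2 s t j - Z (lift k j) = Z k * (pt2 s t j - affine_point k Z j).
    by rewrite mulrBr /affine_point [Z k * (_ / _)]mulrCA mulfV ?mulr1.
  rewrite normrM mulrC -ltr_pdivlMr ?normr_gt0 //.
  by have [->|->] : j = 0 \/ j = 1 by
    case: j => [[|[|//]] ?]; [left|right]; apply: val_inj.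
have c1 : c = 1.
  by have := cP k; rewrite /ext unlift_none mulr1 => /esym/eqP; rewrite -subr_eq0
    -[X in _ - X]mul1r -mulrBl mulf_eq0 (negPf Zk) orbF subr_eq0 => /eqP.
have yE j : pt2 s t j = affine_point k Z j.
  have := cP (lift k j); rewrite /ext liftK c1 mul1r /affine_point => <-.
  by rewrite mulrC mulKf.
by case: st => /eqP[]; rewrite -yE.
Qed.

End Recursion.

Theorem lemma22 (R : realType) (d : nat) (P : {mpoly R[3]}) (X : 'I_3 -> R)
    (k : 'I_3) (P_nonneg : nonneg_form d P) (X_isolated : isolated_real_zero P X)
    (k_chart : X k != 0)
    (mult2 : multiplicity (dehomogenize k P) (affine_point k X) = 2%N) :
  exists n : nat,
    delta_invariant (complexify (dehomogenize k P))
                    (complex_point (affine_point k X)) n /\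
    sos_invariant (dehomogenize k P) (affine_point k X) n%:R.
Proof.
rewrite [affine_point k X]pt2_eta in mult2 *.
apply: sos_eq_delta => //.
exact: isolated_min_dehomogenize P_nonneg X_isolated k_chart.
Qed.
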